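(* Let $1<p<q$, let $\mathbf{M}:\mathbb{R}^3\to\mathbb{R}^{3\times 3}$ be a matrix-valued function, and let $\rho,\mu,v_p,v_q:\mathbb{R}^3\to(0,\infty)$ be radially symmetric $C^2$-functions satisfying $$v_p(x)=\left(\frac{\mu(x)^{q-p}}{v_q(x)^{1-p}}\right)^{\frac1{q-1}}\qquad\text{for all }x\in\mathbb{R}^3 .$$ Set $$\tau(x)=\left(\frac{\mu(x)}{v_q(x)}\right)^{\frac1{q-1}},\qquad \sigma(x)=\left(\frac{\mu(x)}{\rho(x)}\right)^{\frac12},\qquad T=2\pi\sigma(0).$$ Assume that: (H1) $\sigma(0)\sigma(x)<1$ for all $x\in\mathbb{R}^3\setminus\{0\}$; (H2) $|1-\sigma(0)\sigma(x)|^{\frac1{q-1}}\to0$ in the $C^2$-sense as $x\to0$; (H3) $\sup_{x\in\mathbb{R}^3}|1-\sigma(0)\sigma(x)|\,e^{\gamma(q-1)|x|}<\infty$ for some $\gamma>0$; (H4) $\sup_{x\in\mathbb{R}^3}\tau(x)<\infty$. Then there exists a continuum of $T$-periodic $\mathbb{C}^3$-valued monochromatic breather solutions $\mathbf{u}(x,t)=e^{i\frac{2\pi}{T}t}\mathbf{u}(x)$ of the equation $$\rho(x)\mathbf{u}_{tt}+\nabla\times(\mathbf{M}(x)\nabla\times\mathbf{u})+\mu(x)\mathbf{u}+v_p(x)|\mathbf{u}|^{p-1}\mathbf{u}+v_q(x)|\mathbf{u}|^{q-1}\mathbf{u}=0,\qquad (x,t)\in\mathbb{R}^3\times\mathbb{R},$$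 with $\sup_{x\in\mathbb{R}^3}|\mathbf{u}(x)|e^{\gamma|x|}<\infty$ (with the $\gamma$ of (H3)).
   Context: A breather is a classical solution that is periodic in time and spatially exponentially localized; here it is $\mathbb{C}^3$-valued, and $|\cdot|$ is the Euclidean (Hermitian) norm on $\mathbb{C}^3$. The curl $\nabla\times$ acts in the variable $x\in\mathbb{R}^3$. The matrix function $\mathbf{M}$ is arbitrary. A function on $\mathbb{R}^3$ is radially symmetric if it depends only on $|x|$. A real-valued function $U$ satisfies $U(x)\to0$ in the $C^2$-sense as $x\to0$ if $U(x)\to0$, $\nabla U(x)\to0$ and $D^2U(x)\to0$ as $x\to0$. *)

(* Defs.v *)
From HB Require Import structures.
From mathcomp Require Import all_boot all_order all_algebra.
From mathcomp Require Import all_classical all_reals all_analysis.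
From mathcomp Require Export complex.

Set Implicit Arguments.
Unset Strict Implicit.
Unset Printing Implicit Defensive.

Import Order.TTheory GRing.Theory Num.Theory.
Import numFieldNormedType.Exports.

Local Open Scope classical_set_scope.
Local Open Scope ring_scope.
Local Open Scope complex_scope.

Section Euclidean.
Variable R : realType.

Definition basis3 (i : 'I_3) : 'cV[R]_3 := delta_mx i 0.

(* Euclidean norms; the library norm `|x| on matrices is the sup norm. *)
Definition enorm (x : 'cV[R]_3) : R := Num.sqrt (\sum_i x i 0 ^+ 2).

Definition hnorm (z : 'cV[R[i]]_3) : R :=
  Num.sqrt (\sum_i (complex.Re (z i 0) ^+ 2 + complex.Im (z i 0) ^+ 2)).

Definition radial (f : 'cV[R]_3 -> R) : Prop :=
  forall x y, enorm x = enorm y -> f x = f y.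

(* The directions v range over the whole space, so that the same definition
   serves for R^3 and for R^3 x R.  On a finite-dimensional V this is the usual
   class C^k. *)
Fixpoint Ck (V : normedModType R) (k : nat) (f : V -> R) : Prop :=
  continuous f /\
  (if k is k'.+1 then
     forall v : V, (forall x, derivable f x v) /\ Ck k' (fun x => 'D_v f x)
   else True).

(* The complex field R[i] is not a normed module over R in the library, so
   derivatives of complex-valued functions of real variables are taken
   separately for the real and the imaginary part. *)
Definition CkC (V : normedModType R) (k : nat) (F : V -> 'cV[R[i]]_3) : Prop :=
  forall i, Ck k (fun w => complex.Re (F w i 0)) /\
            Ck k (fun w => complex.Im (F w i 0)).

Definition derC (V : normedModType R) (v : V) (F : V -> 'cV[R[i]]_3) (w : V) :
    'cV[R[i]]_3 :=
  \col_i ('D_v (fun y => complex.Re (F y i 0)) w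
          +i* 'D_v (fun y => complex.Im (F y i 0)) w).

(* The indices i + 1 and i + 2 in 'I_3 are taken modulo 3. *)
Definition curl (F : 'cV[R]_3 -> 'cV[R[i]]_3) (x : 'cV[R]_3) : 'cV[R[i]]_3 :=
  \col_i (derC (basis3 (i + 1)) F x (i + 2) 0
          - derC (basis3 (i + 2)) F x (i + 1) 0).

Definition to0_C2 (f : 'cV[R]_3 -> R) : Prop :=
  [/\ \forall x \near (0 : 'cV[R]_3)^', forall i j, derivable f x (basis3 i) /\
        derivable (fun y => 'D_(basis3 i) f y) x (basis3 j),
      f x @[x --> (0 : 'cV[R]_3)^'] --> (0 : R),
      forall i, 'D_(basis3 i) f x @[x --> (0 : 'cV[R]_3)^'] --> (0 : R) &
      forall i j, 'D_(basis3 j) (fun y => 'D_(basis3 i) f y) x @[x --> (0 : 'cV[R]_3)^']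
        --> (0 : R)].

End Euclidean.

Section Equation.
Variable R : realType.
Implicit Types (p q T : R) (M : 'cV[R]_3 -> 'M[R]_3)
  (rho mu vp vq : 'cV[R]_3 -> R) (U : 'cV[R]_3 * R -> 'cV[R[i]]_3).

Definition tau q mu vq (x : 'cV[R]_3) : R := (mu x / vq x) `^ (q - 1)^-1.

Definition sigma rho mu (x : 'cV[R]_3) : R := Num.sqrt (mu x / rho x).

Definition M_curl M U (t : R) (x : 'cV[R]_3) : 'cV[R[i]]_3 :=
  map_mx (fun r : R => r%:C) (M x) *m curl (fun y => U (y, t)) x.

Definition d_tt U (x : 'cV[R]_3) (t : R) : 'cV[R[i]]_3 :=
  derC (1 : R) (derC (1 : R) (fun s => U (x, s))) t.

(* M carries no regularity, hence the separate requirement on M (curl U),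
   which makes the outer curl a classical derivative. *)
Definition classical_solution p q M rho mu vp vq U : Prop :=
  [/\ CkC 2 U,
      forall t, CkC 1 (M_curl M U t) &
      forall x t,
        (rho x)%:C *: d_tt U x t + curl (M_curl M U t) x
        + (mu x)%:C *: U (x, t)
        + (vp x * hnorm (U (x, t)) `^ (p - 1))%:C *: U (x, t)
        + (vq x * hnorm (U (x, t)) `^ (q - 1))%:C *: U (x, t) = 0].

Definition exp_localized (delta : R) U : Prop :=
  has_ubound [set hnorm (U xt) * expR (delta * enorm xt.1) | xt in [set: _]].

Definition breather p q M rho mu vp vq T U : Prop :=
  [/\ classical_solution p q M rho mu vp vq U,
      forall x t, U (x, t + T) = U (x, t) &
      exists2 delta, 0 < delta & exp_localized delta U].

Definition monochromatic T (u : 'cV[R]_3 -> 'cV[R[i]]_3)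
    (xt : 'cV[R]_3 * R) : 'cV[R[i]]_3 :=
  let theta := 2 * pi / T * xt.2 in (cos theta +i* sin theta) *: u xt.1.

Definition time_translate (t0 : R) U (xt : 'cV[R]_3 * R) : 'cV[R[i]]_3 :=
  U (xt.1, xt.2 + t0).

(* The equation is autonomous in t, so a single nonzero breather always comes
   with its orbit of time translates.  A continuum of solutions is therefore a
   set with the cardinality of the continuum whose elements are distinct even up
   to time translation. *)
Definition continuum_mod_time (A : set ('cV[R]_3 * R -> 'cV[R[i]]_3)) : Prop :=
  (A #= [set: R])%card /\
  forall U V t0, A U -> A V -> V = time_translate t0 U -> U = V.

End Equation.

(* Main.v *)
Require Import Defs.
From mathcomp Require Import all_boot all_order all_algebra.
From mathcomp Require Import all_classical all_reals all_analysis.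
From mathcomp Require Import ring lra.

(* A field of the form x |-> g(|x|) x is curl-free even for complex-valued g, so
   for u(x, t) = exp(i(t + a|x|^2)) S(|x|) x/|x| the equation loses its curl term
   and reduces, |x| by |x|, to a scalar equation for the amplitude S, whatever
   the phase parameter a is.  (H2) forces sigma(0) = 1, hence T = 2 pi.  Writing
   S = tau y, the relation between v_p, v_q and mu turns the scalar equation into
   y^(p-1) + y^(q-1) = sigma^(-2) - 1, solvable with y > 0 off the origin by (H1),
   and (H3), (H4) give the exponential decay of S.

   The delicate point is C^2 regularity at the origin.  With
   w = (1 - sigma)^(1/(q-1)), we have y <= C w, and in logarithmic coordinates y
   is a function of w with bounded derivatives up to order two, so that S, S' and
   S'' are O(w), O(w + |w'|) and O(w + |w''| + w'^2/w).  Since w >= 0 and w'' -> 0,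
   Landau's inequality w'^2 <= 4 sup|w''| w makes the last term vanish too. *)

Set Implicit Arguments.
Unset Strict Implicit.
Unset Printing Implicit Defensive.

Import Order.TTheory GRing.Theory Num.Theory.
Import numFieldNormedType.Exports.

Local Open Scope classical_set_scope.
Local Open Scope ring_scope.
Local Open Scope complex_scope.

(** * C^k functions on a set *)

(** Logarithms fit because sigma^(-2) - 1 = w^Q (1 + sigma)/sigma^2 with Q = q - 1: the logarithm of
    the right-hand side is Q ln w plus a function that is C^2 across the origin. All singular
    behaviour then sits in w'/w and w''/w, and the factor w hidden in S absorbs one denominator. The
    obstacle is that w vanishes at the origin at an unknown rate, so y cannot be expanded there;
    only comparison with w is available. The vanishing of S, S', S'' at 0+ lets S(|x|) x/|x| extend
    in C^2: integrating S'' -> 0 twice gives S = o(r^2), which beats the singular derivatives of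
    x/|x|. The phase uses |x|^2 because it is smooth at the origin, because its gradient 2ax is
    parallel to the field and so adds nothing to the curl, and because phase differences that vary
    with the radius cannot be undone by a shift in time. *)

Section CkOn.
Variable R : realType.

(* [Ck] localized to A. The derivatives are witnesses prescribed on A only, rather
   than ['D_v f], so that closed formulas for them can be used off a singularity. *)
Fixpoint Ckon (V : normedModType R) (A : set V) (k : nat) (f : V -> R) : Prop :=
  (forall x, A x -> {for x, continuous f}) /\
  (if k is k'.+1 then
     forall v : V, exists2 df : V -> R,
       forall x, A x -> is_derive x v f (df x) & Ckon A k' df
   else True).

Lemma Ckon_continuous (V : normedModType R) (A : set V) k (f : V -> R) x :
  Ckon A k f -> A x -> {for x, continuous f}.
Proof. by case: k => [|k] [+ _]; apply. Qed.

Lemma CkonW (V : normedModType R) (A : set V) k (f : V -> R) :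
  Ckon A k.+1 f -> Ckon A k f.
Proof.
elim: k f => [|k IH] f [fc fd]; first by split.
by split=> // v; have [df dfE /IH] := fd v; exists df.
Qed.

Lemma Ckon_le (V : normedModType R) (A : set V) j k (f : V -> R) :
  (j <= k)%N -> Ckon A k f -> Ckon A j f.
Proof.
elim: k => [|k IH]; first by rewrite leqn0 => /eqP->.
by rewrite leq_eqVlt => /predU1P[->//|]; rewrite ltnS => /IH{}IH /CkonW.
Qed.

Lemma Ckon_sub (V : normedModType R) (A B : set V) k (f : V -> R) :
  B `<=` A -> Ckon A k f -> Ckon B k f.
Proof.
move=> BA; elim: k f => [|k IH] f [fc fd]; split => //; try by move=> x /BA/fc.
by move=> v; have [df dfE /IH] := fd v; exists df => // x /BA/dfE.
Qed.

Lemma Ckon_eq (V : normedModType R) (A : set V) k (f g : V -> R) :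
  open A -> (forall x, A x -> f x = g x) -> Ckon A k f -> Ckon A k g.
Proof.
move=> oA fg Hf.
have nfg x : A x -> \forall y \near x, f y = g y.
  move=> Ax; have : \forall y \near x, A y by apply: open_nbhs_nbhs; split.
  by apply: filterS => y /fg.
have gc x : A x -> {for x, continuous g}.
  move=> Ax; have := Ckon_continuous Hf Ax.
  rewrite /prop_for /continuous_at -(fg _ Ax) => H.
  by apply: cvg_trans H; apply: near_eq_cvg; exact: nfg.
case: k Hf => [|k] [fc fd]; split=> // v.
have [df dfE Hdf] := fd v; exists df => // x Ax.
by have := dfE _ Ax; apply: near_eq_is_derive; apply: filterS (nfg _ Ax) => y.
Qed.

(** On the whole space uniqueness of the derivative forces every witness to be ['D_v f]. *)
Lemma Ck_Ckon (V : normedModType R) k (f : V -> R) :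
  Ck k f <-> Ckon setT k f.
Proof.
elim: k f => [|k IH] f; split => -[fc fd]; split => //; try by move=> x *; apply: fc.
  by move=> v; have [fv /IH] := fd v; exists ('D_v f) => // x _; exact/derivableP.
move=> v; have [df dfE Hdf] := fd v.
split; first by move=> x; have [] := dfE x I.
have -> : (fun x => 'D_v f x) = df by apply/funext => x; have [] := dfE x I.
exact/IH.
Qed.

Lemma Ckon_cst (V : normedModType R) (A : set V) k (c : R) :
  Ckon A k (fun=> c).
Proof.
elim: k c => [|k IH] c; split => //; try by move=> x _; exact: cvg_cst.
by move=> v; exists (fun=> 0) => // x _; exact: is_derive_cst.
Qed.

Lemma CkonD (V : normedModType R) (A : set V) k (f g : V -> R) :
  Ckon A k f -> Ckon A k g -> Ckon A k (fun x => f x + g x).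
Proof.
elim: k f g => [|k IH] f g [fc fd] [gc gd]; split => //.
- by move=> x Ax; apply: continuousD; [exact: fc|exact: gc].
- by move=> x Ax; apply: continuousD; [exact: fc|exact: gc].
move=> v; have [df dfE Hdf] := fd v; have [dg dgE Hdg] := gd v.
exists (fun x => df x + dg x); last exact: IH.
by move=> x Ax; have ? := dfE _ Ax; have ? := dgE _ Ax; exact: is_deriveD.
Qed.

Lemma CkonM (V : normedModType R) (A : set V) k (f g : V -> R) :
  Ckon A k f -> Ckon A k g -> Ckon A k (fun x => f x * g x).
Proof.
elim: k f g => [|k IH] f g Hf Hg; have [fc fd] := Hf; have [gc gd] := Hg; split => //.
- by move=> x Ax; apply: continuousM; [exact: fc|exact: gc].
- by move=> x Ax; apply: continuousM; [exact: fc|exact: gc].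
move=> v; have [df dfE Hdf] := fd v; have [dg dgE Hdg] := gd v.
exists (fun x => f x * dg x + g x * df x).
  by move=> x Ax; have ? := dfE _ Ax; have ? := dgE _ Ax; exact: is_deriveM.
by apply: CkonD; apply: IH => //; exact: CkonW.
Qed.

Lemma CkonN (V : normedModType R) (A : set V) k (f : V -> R) :
  Ckon A k f -> Ckon A k (fun x => - f x).
Proof.
move=> Hf; have -> : (fun x => - f x) = (fun x => -1 * f x).
  by apply/funext => x; rewrite mulN1r.
by apply: CkonM => //; exact: Ckon_cst.
Qed.

Lemma CkonB (V : normedModType R) (A : set V) k (f g : V -> R) :
  Ckon A k f -> Ckon A k g -> Ckon A k (fun x => f x - g x).
Proof. by move=> Hf Hg; apply: CkonD => //; exact: CkonN. Qed.

Lemma Ckon_sum (V : normedModType R) (A : set V) k n (f : 'I_n -> V -> R) :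
  (forall i, Ckon A k (f i)) -> Ckon A k (fun x => \sum_i f i x).
Proof.
elim: n f => [|n IH] f Hf.
  rewrite (_ : (fun x => _) = fun=> 0); first exact: Ckon_cst.
  by apply/funext => x; rewrite big_ord0.
rewrite (_ : (fun x => _) =
  fun x => (\sum_i f (widen_ord (leqnSn n) i) x) + f ord_max x); last first.
  by apply/funext => x; rewrite big_ord_recr.
by apply: CkonD => //; apply: IH.
Qed.

(** A directional derivative is a one-variable derivative at h = 0, so one-variable rules apply in
    any space. *)
Lemma is_derive_line (V W : normedModType R) (f : V -> W) x v df :
  is_derive x v f df <-> is_derive (0 : R) 1 (fun h : R => f (h *: v + x)) df.
Proof.
have E : 'D_v f x = 'D_1 (fun h : R => f (h *: v + x)) 0.
  rewrite /derive; set g1 := fun h => h^-1 *: _; set g2 := fun h => h^-1 *: _.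
  suff -> : g1 = g2 by [].
  by rewrite funeqE /g1 /g2 => h /=; rewrite addr0 scale0r add0r [_%:A]mulr1.
split=> -[d dE].
  by apply: DeriveDef; [exact: (derivable1P f x v).1|rewrite -E].
by apply: DeriveDef; [exact: (derivable1P f x v).2|rewrite E].
Qed.

Lemma is_derive_chain (V : normedModType R) (f : V -> R) (phi : R -> R) x v df dphi :
  is_derive x v f df -> is_derive (f x) 1 phi dphi ->
  is_derive x v (fun y => phi (f y)) (dphi * df).
Proof.
move=> /is_derive_line Hf Hphi; apply/is_derive_line.
by apply: (@is_derive1_comp R phi (fun h => f (h *: v + x))); rewrite scale0r add0r.
Qed.

Lemma Ckon_comp (V : normedModType R) (A : set V) (B : set R) k
    (f : V -> R) (phi : R -> R) :
  (forall x, A x -> B (f x)) -> Ckon A k f -> Ckon B k phi ->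
  Ckon A k (fun x => phi (f x)).
Proof.
move=> AB; elim: k f phi AB => [|k IH] f phi AB Hf Hphi;
    have [fc fd] := Hf; have [pc pd] := Hphi; split => //.
- by move=> x Ax; apply: (@continuous_comp _ _ _ f phi); [exact: fc|exact/pc/AB].
- by move=> x Ax; apply: (@continuous_comp _ _ _ f phi); [exact: fc|exact/pc/AB].
move=> v; have [df dfE Hdf] := fd v; have [dp dpE Hdp] := pd 1.
exists (fun x => dp (f x) * df x).
  by move=> x Ax; apply: is_derive_chain; [exact: dfE|exact/dpE/AB].
by apply: CkonM => //; apply: IH => //; exact: CkonW.
Qed.

(** An affine map with linear part [b] sends lines to lines, so differentiating f o l along v means
    differentiating f along b v. This serves both for the restriction to an axis and for the
    projection of space-time to space. *)
Lemma Ckon_affine (V W : normedModType R) (A : set W) k (f : W -> R) (l : V -> W) (b : V -> W) :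
  (forall x h v, l (h *: v + x) = h *: b v + l x) -> continuous l ->
  Ckon A k f -> Ckon (l @^-1` A) k (fun x => f (l x)).
Proof.
move=> lE lc; elim: k f => [|k IH] f [fc fd]; split => //.
- by move=> x Ax; apply: (@continuous_comp _ _ _ l f); [exact: lc|exact: fc].
- by move=> x Ax; apply: (@continuous_comp _ _ _ l f); [exact: lc|exact: fc].
move=> v; have [df dfE Hdf] := fd (b v).
exists (fun x => df (l x)); last exact: IH.
move=> x Ax; have /is_derive_line H := dfE _ Ax; apply/is_derive_line.
by under eq_fun do rewrite lE.
Qed.

Lemma Ckon_lin (V : normedModType R) (A : set V) k (l b : V -> R) :
  (forall x h v, l (h *: v + x) = h * b v + l x) -> continuous l -> Ckon A k l.
Proof.
move=> lE lc; case: k => [|k]; split => //; try by move=> x _; exact: lc.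
move=> v; exists (fun=> b v); last exact: Ckon_cst.
move=> x _; apply/is_derive_line; under eq_fun do rewrite lE.
by apply: is_derive_eq; rewrite scaler0 add0r addr0 [_%:A]mulr1.
Qed.

Lemma Ckon_id (A : set R) k : Ckon A k (fun x => x).
Proof. by apply: (@Ckon_lin _ _ _ _ id) => // x; exact: cvg_id. Qed.

(** A bootstrap: when the derivative is an expression in f itself, as for [expR], [Num.sqrt] or the
    solution of an autonomous ODE, each order of regularity of f yields the next one. *)
Lemma Ckon_intro (A : set R) (f df : R -> R) k :
  (forall x, A x -> is_derive x 1 f (df x)) ->
  (forall j, (j < k)%N -> Ckon A j f -> Ckon A j df) -> Ckon A k f.
Proof.
move=> dfE; have fc x : A x -> {for x, continuous f}.
  move=> Ax; apply: differentiable_continuous; apply/derivable1_diffP.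
  by have [] := dfE _ Ax.
elim: k => [|k IH] H; first by split.
split=> // v; exists (fun x => v * df x).
  move=> x Ax; have /is_derive_line Hf := dfE _ Ax; apply/is_derive_line.
  have -> : (fun h => f (h *: v + x)) = (fun h => f (h *: 1 + x)) \o (fun h => h * v).
    by apply/funext => h /=; rewrite [_ *: 1]mulr1.
  apply: is_derive_eq; first apply: is_derive1_comp.
    by rewrite mul0r; exact: Hf.
  by rewrite scaler0 add0r [_%:A]mulr1 mulrC.
apply: CkonM; first exact: Ckon_cst.
by apply: (H k) => //; apply: IH => j jk; apply: (H j); rewrite ltnS ltnW.
Qed.

Lemma Ckon_inv k : Ckon [set x : R | x != 0] k (fun x => x^-1).
Proof.
apply: (@Ckon_intro _ _ (fun x => - (x^-1 * x^-1))).
  move=> x x0; apply: is_derive_eq; first exact: (@is_deriveV R id).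
  by rewrite [_%:A]mulr1 /= expr2 invfM.
by move=> j _ H; apply: CkonN; exact: CkonM.
Qed.

Lemma Ckon_expR k : Ckon setT k (@expR R).
Proof. by apply: (@Ckon_intro _ _ (@expR R)) => // x _; exact: is_derive_expR. Qed.

Lemma Ckon_ln k : Ckon [set x : R | 0 < x] k (@ln R).
Proof.
apply: (@Ckon_intro _ _ (fun x => x^-1)).
by move=> j _ _; apply: Ckon_sub (Ckon_inv j) => x /= /lt0r_neq0.
Qed.

Lemma Ckon_sqrt k : Ckon [set x : R | 0 < x] k (@Num.sqrt R).
Proof.
apply: (@Ckon_intro _ _ (fun x => (2 * Num.sqrt x)^-1)).
move=> j _ H; apply: (@Ckon_comp _ _ [set x | x != 0] _ (fun x => 2 * Num.sqrt x)).
- by move=> x /= x0; rewrite mulf_neq0 ?gt_eqF ?sqrtr_gt0.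
- by apply: CkonM => //; exact: Ckon_cst.
- exact: Ckon_inv.
Qed.

Lemma Ckon_powR k (a : R) : Ckon [set x : R | 0 < x] k (fun x => x `^ a).
Proof.
have op : open [set x : R | 0 < x] by exact: open_gt.
apply: (@Ckon_eq _ _ _ (fun x => expR (a * ln x))) => //.
  by move=> x /= x0; rewrite /powR gt_eqF.
apply: (@Ckon_comp _ _ setT) => //; last exact: Ckon_expR.
by apply: CkonM; [exact: Ckon_cst|exact: Ckon_ln].
Qed.

Lemma Ckon_sincos k : Ckon setT k (@sin R) /\ Ckon setT k (@cos R).
Proof.
elim: k => [|k [IHs IHc]].
  by split; (split=> // x _); [exact: continuous_sin|exact: continuous_cos].
split.
  apply: (@Ckon_intro _ _ (@cos R)) => j.
  by rewrite ltnS => jk _; apply: Ckon_le IHc.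
apply: (@Ckon_intro _ _ (fun x => - sin x)) => j.
by rewrite ltnS => jk _; apply: CkonN; apply: Ckon_le IHs.
Qed.

Section CkonComp.
Variables (V : normedModType R) (A : set V) (k : nat) (f : V -> R).
Hypothesis Hf : Ckon A k f.

Lemma Ckon_comp_expR : Ckon A k (fun x => expR (f x)).
Proof. by apply: (@Ckon_comp V A setT k f expR) => //; exact: Ckon_expR. Qed.

Lemma Ckon_comp_inv :
  (forall x, A x -> f x != 0) -> Ckon A k (fun x => (f x)^-1).
Proof. by move=> f0; apply: (Ckon_comp f0 Hf); exact: Ckon_inv. Qed.

Hypothesis f_gt0 : forall x, A x -> 0 < f x.

Lemma Ckon_comp_ln : Ckon A k (fun x => ln (f x)).
Proof. by apply: (Ckon_comp f_gt0 Hf); exact: Ckon_ln. Qed.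

Lemma Ckon_comp_sqrt : Ckon A k (fun x => Num.sqrt (f x)).
Proof. by apply: (Ckon_comp f_gt0 Hf); exact: Ckon_sqrt. Qed.

Lemma Ckon_comp_powR a : Ckon A k (fun x => f x `^ a).
Proof. by apply: (Ckon_comp f_gt0 Hf (phi := fun x => x `^ a)); exact: Ckon_powR. Qed.

End CkonComp.

End CkOn.

(** * The amplitude equation in logarithmic coordinates *)

Section LogInverse.
Variables (R : realType) (P Q : R).
Hypotheses (P_gt0 : 0 < P) (PQ : P < Q).

Let Q_gt0 : 0 < Q := lt_trans P_gt0 PQ.
Let F (Y : R) : R := expR (P * Y) + expR (Q * Y).
Let dF (Y : R) : R := P * expR (P * Y) + Q * expR (Q * Y).

Let F_gt0 Y : 0 < F Y.
Proof. by rewrite addr_gt0 ?expR_gt0. Qed.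

Let dF_gt0 Y : 0 < dF Y.
Proof. by rewrite addr_gt0 ?mulr_gt0 ?expR_gt0. Qed.

Let is_derive_expM (c x : R) : is_derive x 1 (fun Y => expR (c * Y)) (c * expR (c * x)).
Proof.
rewrite mulrC; apply: is_derive_chain.
apply: is_derive_eq; rewrite /GRing.scale /=; ring.
Qed.

Let is_derive_F (x : R) : is_derive x 1 F (dF x).
Proof. exact: is_deriveD. Qed.

Let F_cont : continuous F.
Proof.
by move=> x; apply: differentiable_continuous; apply/derivable1_diffP.
Qed.

Let F_inj : injective F.
Proof.
have lt x y : x < y -> F x < F y.
  by move=> xy; rewrite ltrD // ltr_expR ltr_pM2l.
by move=> x y; case: (ltgtP x y) => // /lt + e; rewrite e ltxx.
Qed.

Let F_surj L : {Y | F Y = expR L}.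
Proof.
(* Bracket for the intermediate value theorem. At [Y1] the first exponential alone equals expR L. At
   [Y0] <= 0 the second exponential is at most the first, so F Y0 <= 2 expR (P Y0) = expR (-
   |L|). *)
apply: cid; pose Y1 := L / P; pose Y0 := - (`|L| + ln 2) / P.
have l2 : 0 <= ln 2 :> R by rewrite ln_ge0 // ler1n.
have Y01 : Y0 <= Y1.
  rewrite ler_pM2r ?invr_gt0 //; have := ler_norm (- L); rewrite normrN; lra.
have F1 : expR L <= F Y1.
  by rewrite /F /Y1 mulrC divfK ?gt_eqF // lerDl expR_ge0.
have Y0le : Y0 <= 0 by rewrite pmulr_lle0 ?invr_gt0 // oppr_le0 addr_ge0.
have F0 : F Y0 <= expR L.
  apply: (@le_trans _ _ (expR (P * Y0) * 2)).
    by rewrite mulr_natr mulr2n lerD2l ler_expR ler_wnM2r // ltW.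
  rewrite -[2 in leLHS](@lnK R) ?posrE // -expRD ler_expR.
  rewrite /Y0 mulrC divfK ?gt_eqF //.
  have := ler_norm (- L); rewrite normrN; lra.
have [||c _ cE] := @IVT R F Y0 Y1 (expR L) Y01.
- exact: continuous_subspaceT.
- by rewrite ge_min F0 le_max F1 orbT.
by exists c.
Qed.

Let E L : R := sval (F_surj L).

Let EE L : F (E L) = expR L. Proof. exact: svalP (F_surj L). Qed.

Let lnF Y := ln (F Y).

Let lnFK : cancel lnF E.
Proof. by move=> Y; apply: F_inj; rewrite EE lnK // posrE. Qed.

Let EK : cancel E lnF.
Proof. by move=> L; rewrite /lnF EE expRK. Qed.

Let G Y := F Y / dF Y.

Let is_derive_lnF (x : R) : is_derive x 1 lnF ((F x)^-1 * dF x).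
Proof. exact: is_derive_chain (is_derive1_ln (F_gt0 x)). Qed.

Let is_derive_E (L : R) : is_derive L 1 E (G (E L)).
Proof.
rewrite -{1}[L]EK /G -[F _]invrK -invfM.
apply: (@is_derive_inverse R lnF).
- by near=> x; exact: lnFK.
- near=> x; apply: differentiable_continuous; apply/derivable1_diffP.
  by have [] := is_derive_lnF x.
- exact: is_derive_lnF.
- by rewrite mulf_neq0 ?invr_neq0 ?gt_eqF.
Unshelve. all: by end_near. Qed.

(** With a = expR (P Y) and b = expR (Q Y), the numerator of (F/F')' is (Pa + Qb)^2 - (a + b)(P^2 a
    + Q^2 b) = - (Q - P)^2 ab. *)
Let dG Y := - (Q - P) ^+ 2 * (expR (P * Y) * expR (Q * Y)) / dF Y ^+ 2.

Let is_derive_G (x : R) : is_derive x 1 G (dG x).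
Proof.
have dF' : is_derive x 1 dF (P ^+ 2 * expR (P * x) + Q ^+ 2 * expR (Q * x)).
  have ? := is_derive_expM P x; have ? := is_derive_expM Q x.
  apply: is_derive_eq; rewrite /GRing.scale /=; ring.
have nz : dF x != 0 by rewrite gt_eqF.
have ? := is_deriveV nz dF'.
apply: is_derive_eq.
rewrite /dG /F /GRing.scale /=; move: nz; rewrite /dF => nz; by field.
Qed.

Let CkF k : Ckon setT k F.
Proof.
have CE c : Ckon setT k (fun Y : R => expR (c * Y)).
  by apply: Ckon_comp_expR; apply: CkonM; [exact: Ckon_cst|exact: Ckon_id].
exact: CkonD.
Qed.

Let CkdF k : Ckon setT k dF.
Proof.
have CE c : Ckon setT k (fun Y : R => expR (c * Y)).
  by apply: Ckon_comp_expR; apply: CkonM; [exact: Ckon_cst|exact: Ckon_id].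
by apply: CkonD; apply: CkonM => //; exact: Ckon_cst.
Qed.

Let CkG k : Ckon setT k G.
Proof.
apply: CkonM; first exact: CkF.
by apply: Ckon_comp_inv; [exact: CkdF|move=> x _; rewrite gt_eqF].
Qed.

(** [E] solves the autonomous equation E' = G(E) with [G] smooth, so its regularity bootstraps. *)
Let CkE k : Ckon setT k E.
Proof.
apply: (@Ckon_intro _ _ _ (fun L => G (E L))) => // j _ HE.
exact: (@Ckon_comp _ _ _ setT).
Qed.

(** P < Q gives F' >= P F. *)
Let G_ge0 Y : 0 <= G Y <= P^-1.
Proof.
rewrite /G; apply/andP; split; first by rewrite divr_ge0 // ltW.
rewrite ler_pdivrMr // /F /dF.
rewrite mulrDr !mulrA mulVf ?gt_eqF // mul1r lerD2l ler_peMl ?expR_ge0 //.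
by rewrite ler_pdivlMl // mulr1 ltW.
Qed.

(** (Pa + Qb)^2 = (Pa - Qb)^2 + 4PQab >= PQab. *)
Let dG_le Y : `|dG Y| <= (Q - P) ^+ 2 / (P * Q).
Proof.
have := expR_gt0 (Q * Y); have := expR_gt0 (P * Y).
rewrite /dG /dF; set a := expR (P * Y); set b := expR (Q * Y) => a0 b0.
have d0 : 0 < (P * a + Q * b) ^+ 2 by rewrite exprn_gt0 // addr_gt0 ?mulr_gt0.
have c0 : 0 <= (Q - P) ^+ 2 by exact: sqr_ge0.
rewrite !mulNr normrN ger0_norm; last first.
  by apply: divr_ge0; [apply: mulr_ge0 => //; apply: mulr_ge0|]; exact: ltW.
rewrite -mulrA ler_wpM2l //.
rewrite ler_pdivrMr // ler_pdivlMl ?mulr_gt0 //.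
have := sqr_ge0 (P * a - Q * b); have := mulr_gt0 (mulr_gt0 P_gt0 Q_gt0) (mulr_gt0 a0 b0).
nra.
Qed.

(* The map [expR L |-> expR (E L)] inverts [y |-> y `^ P + y `^ Q]; in
   logarithmic coordinates this inverse has two globally bounded derivatives. *)
Lemma log_inverse : exists E E1 E2 : R -> R, exists C : R,
  [/\ forall L, expR (P * E L) + expR (Q * E L) = expR L,
      forall k, Ckon setT k E,
      forall L : R, is_derive L 1 E (E1 L),
      forall L : R, is_derive L 1 E1 (E2 L) &
      0 < C /\ forall L, `|E1 L| <= C /\ `|E2 L| <= C].
Proof.
pose C0 := (Q - P) ^+ 2 / (P * Q).
have C0_ge0 : 0 <= C0 by rewrite divr_ge0 ?sqr_ge0 ?mulr_ge0 ?ltW.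
have Pi : 0 < P^-1 by rewrite invr_gt0.
(* The third function is the chain rule applied to E' = G(E); the constant adds the bounds on the
   first and second derivatives so that it serves for both. *)
exists E, (fun L => G (E L)), (fun L => dG (E L) * G (E L)), (P^-1 + C0 * P^-1).
split=> //; first by move=> L; apply: is_derive_chain.
have ? : 0 <= C0 * P^-1 by rewrite mulr_ge0 // ltW.
split; first by rewrite ltr_wpDr.
move=> L; have /andP[g0 gP] := G_ge0 (E L).
split; first by rewrite ger0_norm // ler_wpDr.
rewrite normrM (ger0_norm g0) ler_wpDl ?(ltW Pi) // ler_pM //; exact: dG_le.
Qed.

End LogInverse.

(** * One-sided limits at the origin and Landau's inequality *)

Section RightLimits.
Variable R : realType.
Implicit Types (f g w : R -> R).

Lemma near_at_right0 (A : R -> Prop) :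
  (\forall r \near (0 : R)^'+, A r) <->
  exists2 d : R, 0 < d & forall r, 0 < r -> r < d -> A r.
Proof.
split=> [[d /= d0 dA]|[d d0 dA]].
  exists d => // r r0 rd; apply: dA => //=.
  by rewrite sub0r normrN gtr0_norm.
exists d => //= r /=; rewrite sub0r normrN => rd r0.
by apply: dA => //; rewrite gtr0_norm in rd.
Qed.

Lemma near_bounded_right0 f : {for 0, continuous f} ->
  exists2 K, 0 < K & \forall r \near (0 : R)^'+, `|f r| <= K.
Proof.
move=> fc; exists (`|f 0| + 1); first by rewrite ltr_wpDl.
have H : \forall r \near (0 : R), `|f r| <= `|f 0| + 1.
  have /cvgrPdist_le/(_ _ ltr01) := fc.
  apply: filterS => r; rewrite distrC => H; rewrite -lerBlDl.
  exact: le_trans (lerB_dist _ _) H.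
by apply: filterS H => r ? _.
Qed.

Lemma MVT_open (f df : R -> R) (a b : R) : a < b ->
  (forall x : R, a <= x <= b -> is_derive x 1 f (df x)) ->
  exists2 c, a < c < b & f b - f a = df c * (b - a).
Proof.
move=> ab fd.
have [||c] := @MVT R f df a b ab.
- by move=> x; rewrite in_itv /= => /andP[ax xb]; apply: fd; rewrite !ltW.
- apply: derivable_within_continuous => x; rewrite in_itv /= => /fd.
  by case.
by rewrite in_itv /=; exists c.
Qed.

(** Mean value theorem on [s, r] with s near 0+. Only the one-sided limit of f enters, never its
    value at 0. *)
Lemma le_of_derive_right0 f (df : R -> R) (d e : R) :
  (forall r : R, 0 < r -> is_derive r 1 f (df r)) ->
  (forall r, 0 < r -> r < d -> `|df r| <= e) ->
  f r @[r --> 0^'+] --> 0 ->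
  forall r, 0 < r -> r < d -> `|f r| <= e * r.
Proof.
move=> fd de f0 r r0 rd; apply/ler_addgt0Pr => h h0.
have /cvgrPdist_le/(_ _ h0)/near_at_right0[d' d'0 H] := f0.
pose s := Num.min (r / 2) (d' / 2).
have s0 : 0 < s by rewrite lt_min !divr_gt0.
have sr : s < r by rewrite gt_min; apply/orP; left; lra.
have sd' : s < d' by rewrite gt_min; apply/orP; right; lra.
have := H _ s0 sd'; rewrite sub0r normrN => fs.
have [|c /andP[sc cr] E] := @MVT_open f df s r sr.
  by move=> x /andP[sx _]; apply: fd; exact: lt_le_trans sx.
have -> : f r = f s + df c * (r - s) by rewrite -E; ring.
apply: le_trans (ler_normD _ _) _; rewrite addrC lerD //.
have dc : `|df c| <= e by apply: de; [exact: lt_trans sc|exact: lt_trans rd].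
have rs : 0 <= r - s by rewrite subr_ge0 ltW.
by rewrite normrM (ger0_norm rs); apply: ler_pM => //; rewrite gerBl ltW.
Qed.

(* Landau's inequality: a nonnegative function cannot descend with slope [w1 r]
   for longer than [w r] allows. *)
Lemma sqr_derive_le w (w1 w2 : R -> R) (d e : R) :
  0 < e ->
  (forall r : R, 0 < r -> is_derive r 1 w (w1 r)) ->
  (forall r : R, 0 < r -> is_derive r 1 w1 (w2 r)) ->
  (forall r, 0 < r -> 0 <= w r) ->
  (forall r, 0 < r -> r < d -> `|w2 r| <= e) ->
  (forall r, 0 < r -> r < d -> `|w1 r| <= e * r) ->
  forall r, 0 < r -> r < d / 2 -> w1 r ^+ 2 <= 4 * e * w r.
Proof.
move=> e0 dw dw1 w_ge0 w2e w1e r r0 rd.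
have rd' : r < d by lra.
have [->|w1r] := eqVneq (w1 r) 0.
  by rewrite expr0n mulr_ge0 ?w_ge0 // mulr_ge0 // ltW.
(* Over a distance [h] the slope changes by at most e h, half of its size. The bound |w1 r| <= e r
   gives h <= r/2, so with r < d/2 the interval [r - h, r + h] stays inside (0, d). *)
pose h := `|w1 r| / (2 * e).
have h0 : 0 < h by rewrite divr_gt0 ?normr_gt0 ?mulr_gt0.
have hr : h <= r / 2.
  rewrite ler_pdivrMr ?mulr_gt0 //; have := w1e _ r0 rd'; lra.
have he : h * (2 * e) = `|w1 r| by rewrite divfK // mulf_neq0 ?pnatr_eq0 ?gt_eqF.
have Lip s : 0 < s -> `|s - r| <= h -> `|w1 s - w1 r| <= `|w1 r| / 2.
  move=> s0 sh; have -> : `|w1 r| / 2 = e * h by rewrite -he; field.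
  have [->|sr] := eqVneq s r; first by rewrite subrr normr0 mulr_ge0 ?ltW.
  have [c c0 [cd E]] : exists2 c, 0 < c & c < d /\ w1 s - w1 r = w2 c * (s - r).
    move: sr sh; case: (ltgtP s r) => // sr _ sh.
      have [|c /andP[sc cr] E] := @MVT_open w1 w2 s r sr.
        by move=> x /andP[sx _]; apply: dw1; exact: lt_le_trans sx.
      exists c; first exact: lt_trans sc.
      split; first exact: lt_trans rd'.
      by rewrite -[LHS]opprB E -mulrN opprB.
    have [|c /andP[sc cr] E] := @MVT_open w1 w2 r s sr.
      by move=> x /andP[sx _]; apply: dw1; exact: lt_le_trans sx.
    exists c; first exact: lt_trans sc.
    split=> //; apply: (lt_trans cr).
    rewrite gtr0_norm ?subr_gt0 // in sh; lra.
  by rewrite E normrM ler_pM //; exact: w2e.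
(* An increasing w is followed back to r - h, a decreasing one forward to r + h; since w >= 0 at the
   far end, w r >= h |w1 r| / 2 = w1 r ^ 2 / (4e). *)
have [w1p|w1n] : w1 r > 0 \/ w1 r < 0 by case: (ltgtP (w1 r) 0) w1r; auto.
  have ab : r - h < r by lra.
  have [|c /andP[sc cr] E] := @MVT_open w w1 _ _ ab.
    by move=> x /andP[sx _]; apply: dw; apply: lt_le_trans sx; lra.
  have wp : 0 <= w (r - h) by apply: w_ge0; lra.
  have c0 : 0 < c by lra.
  have /ler_normlP[H1 _] : `|w1 c - w1 r| <= w1 r / 2.
    rewrite -{2}(gtr0_norm w1p); apply: Lip => //.
    by rewrite ltr0_norm ?subr_lt0 //; lra.
  rewrite (gtr0_norm w1p) in he.
  have W : w1 r / 2 * h <= w r.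
    rewrite -[w r](subrK (w (r - h))) E subKr.
    by rewrite ler_wpDr // ler_wpM2r ?(ltW h0) //; lra.
  have -> : w1 r ^+ 2 = 4 * e * (w1 r / 2 * h).
    by rewrite -he; field.
  by rewrite ler_wpM2l // mulr_ge0 // ltW.
have ab : r < r + h by lra.
have [|c /andP[rc ch] E] := @MVT_open w w1 _ _ ab.
  by move=> x /andP[rx _]; apply: dw; exact: lt_le_trans rx.
have wp : 0 <= w (r + h) by apply: w_ge0; lra.
have c0 : 0 < c by lra.
have /ler_normlP[_ H1] : `|w1 c - w1 r| <= - w1 r / 2.
  rewrite -{2}(ltr0_norm w1n); apply: Lip => //.
  by rewrite gtr0_norm ?subr_gt0 //; lra.
rewrite (ltr0_norm w1n) in he.
have W : - w1 r / 2 * h <= w r.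
  have -> : w r = w (r + h) + - w1 c * h by rewrite -[w (r + h)](subrK (w r)) E; ring.
  by rewrite ler_wpDl // ler_wpM2r ?(ltW h0) //; lra.
have -> : w1 r ^+ 2 = 4 * e * (- w1 r / 2 * h).
  by rewrite -sqrrN -he; field.
by rewrite ler_wpM2l // mulr_ge0 // ltW.
Qed.

End RightLimits.

(** * Vanishing of the amplitude and its first two derivatives at 0+ *)

Section Profile.
Variable R : realType.

Lemma cvg0_le (f m : R -> R) (D : R) :
  (\forall r \near (0 : R)^'+, `|f r| <= D * m r) ->
  m r @[r --> (0 : R)^'+] --> 0 -> f r @[r --> (0 : R)^'+] --> 0.
Proof.
move=> fm m0.
have H : \forall r \near (0 : R)^'+, 0 <= `|f r| <= D * m r.
  by apply: filterS fm => r ->; rewrite normr_ge0.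
suff N : `|f r| @[r --> (0 : R)^'+] --> 0 by exact: (norm_cvg0 N).
apply: (squeeze_cvgr H); first exact: cvg_cst.
have := cvgM (cvg_cst D) m0; rewrite mulr0; exact.
Qed.

Lemma sqr_derive_div_cvg0 (w w1 w2 : R -> R) :
  (forall r : R, 0 < r -> is_derive r 1 w (w1 r)) ->
  (forall r : R, 0 < r -> is_derive r 1 w1 (w2 r)) ->
  (forall r, 0 < r -> 0 < w r) ->
  w1 r @[r --> (0 : R)^'+] --> 0 ->
  w2 r @[r --> (0 : R)^'+] --> 0 ->
  w1 r ^+ 2 / w r @[r --> (0 : R)^'+] --> 0.
Proof.
move=> dw dw1 w0 w1_0 w2_0; apply/cvgrPdist_le => e e0.
(* Cancels the factor 4 in Landau's inequality. *)
have e4 : 0 < e / 4 by rewrite divr_gt0.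
have /cvgrPdist_le/(_ _ e4)/near_at_right0[d d0 w2e] := w2_0.
have {}w2e r : 0 < r -> r < d -> `|w2 r| <= e / 4.
  by move=> r0 rd; have := w2e r r0 rd; rewrite sub0r normrN.
have w1e := le_of_derive_right0 dw1 w2e w1_0.
have H := sqr_derive_le e4 dw dw1 (fun r r0 => ltW (w0 r r0)) w2e w1e.
apply/near_at_right0; exists (d / 2); first by rewrite divr_gt0.
move=> r r0 rd; rewrite sub0r normrN ger0_norm; last first.
  by rewrite divr_ge0 ?sqr_ge0 // ltW // w0.
by rewrite ler_pdivrMr ?w0 //; have := H r r0 rd; lra.
Qed.

Variables (Q C K : R) (E E1 E2 T T1 T2 H H1 H2 w w1 w2 : R -> R).
Hypotheses (Q0 : 0 < Q) (C0 : 0 < C) (K0 : 0 < K).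
Hypothesis E_le : forall L, Q * E L <= L.
Hypothesis dE : forall L : R, is_derive L 1 E (E1 L).
Hypothesis dE1 : forall L : R, is_derive L 1 E1 (E2 L).
Hypothesis E_C : forall L, `|E1 L| <= C /\ `|E2 L| <= C.
Hypothesis dT : forall r : R, 0 < r -> is_derive r 1 T (T1 r).
Hypothesis dT1 : forall r : R, 0 < r -> is_derive r 1 T1 (T2 r).
Hypothesis dH : forall r : R, 0 < r -> is_derive r 1 H (H1 r).
Hypothesis dH1 : forall r : R, 0 < r -> is_derive r 1 H1 (H2 r).
Hypothesis dw : forall r : R, 0 < r -> is_derive r 1 w (w1 r).
Hypothesis dw1 : forall r : R, 0 < r -> is_derive r 1 w1 (w2 r).
Hypothesis w_gt0 : forall r, 0 < r -> 0 < w r.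
Hypothesis TK : \forall r \near (0 : R)^'+, [/\ `|T r| <= K, `|T1 r| <= K & `|T2 r| <= K].
Hypothesis HK : \forall r \near (0 : R)^'+, [/\ `|H r| <= K, `|H1 r| <= K & `|H2 r| <= K].
Hypothesis w_0 : w r @[r --> (0 : R)^'+] --> 0.
Hypothesis w1_0 : w1 r @[r --> (0 : R)^'+] --> 0.
Hypothesis w2_0 : w2 r @[r --> (0 : R)^'+] --> 0.

(** To be used with T = ln tau and H = ln ((1 + sigma)/sigma^2), so that [L] is the logarithm of
    sigma^(-2) - 1 and [S] is tau y. [N1] is the logarithmic derivative of [S], whence S' = S N1 and
    S'' = S (N1^2 + N1'). *)
Let L r := Q * ln (w r) + H r.
Let L1 r := Q * (w1 r / w r) + H1 r.
Let L2 r := Q * (w2 r / w r - (w1 r / w r) ^+ 2) + H2 r.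
Let N1 r := T1 r + E1 (L r) * L1 r.
Let N2 r := T2 r + (E2 (L r) * L1 r ^+ 2 + E1 (L r) * L2 r).
Let S r := expR (T r + E (L r)).

Let dL (r : R) : 0 < r -> is_derive r 1 L (L1 r).
Proof.
move=> r0; have ? := dH r0; have ? := dw r0.
have ? : is_derive r 1 (fun r => ln (w r)) ((w r)^-1 * w1 r).
  exact: is_derive_chain (is_derive1_ln (w_gt0 r0)).
by apply: is_derive_eq; rewrite /L1 /GRing.scale /=; ring.
Qed.

Let dL1 (r : R) : 0 < r -> is_derive r 1 L1 (L2 r).
Proof.
move=> r0; have ? := dH1 r0; have ? := dw1 r0.
have wn : w r != 0 by rewrite gt_eqF ?w_gt0.
have ? := is_deriveV wn (dw r0).
by apply: is_derive_eq; rewrite /L2 /GRing.scale /=; field.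
Qed.

Let dN (r : R) : 0 < r -> is_derive r 1 (fun r => T r + E (L r)) (N1 r).
Proof.
move=> r0; have ? := dT r0.
have ? := is_derive_chain (dL r0) (dE (L r)).
by apply: is_derive_eq.
Qed.

Let dN1 (r : R) : 0 < r -> is_derive r 1 N1 (N2 r).
Proof.
move=> r0; have ? := dT1 r0; have ? := dL1 r0.
have ? := is_derive_chain (dL r0) (dE1 (L r)).
by apply: is_derive_eq; rewrite /N2 /GRing.scale /=; ring.
Qed.

Let dS (r : R) : 0 < r -> is_derive r 1 S (S r * N1 r).
Proof. by move=> r0; have := is_derive_chain (dN r0) (is_derive_expR _). Qed.

Let dS1 (r : R) : 0 < r -> is_derive r 1 (fun r => S r * N1 r) (S r * (N1 r ^+ 2 + N2 r)).
Proof.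
move=> r0; have ? := dS r0; have ? := dN1 r0.
by apply: is_derive_eq; rewrite /GRing.scale /=; ring.
Qed.

(** [M] comes from E(L) <= L/Q = ln w + H/Q. With a = |w'|/w and b = |w''|/w, [D1] and [D2] collect
    the coefficients of K + C(Qa + K) and of K + C(Qa + K)^2 + C(Q(b + a^2) + K), using (Qa + K)^2
    <= 2Q^2 a^2 + 2K^2. *)
Let M := expR (K + K / Q).
Let D1 := K + C * Q + C * K.
Let D2 := K + 2 * C * Q ^+ 2 + 2 * C * K ^+ 2 + C * Q + C * K.

Let S_le : \forall r \near (0 : R)^'+, 0 < r /\ S r <= M * w r.
Proof.
near=> r.
have r0 : 0 < r by near: r; exact: nbhs_right_gt.
split=> //.
have [Tr _ _] : [/\ `|T r| <= K, `|T1 r| <= K & `|T2 r| <= K] by near: r.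
have [Hr _ _] : [/\ `|H r| <= K, `|H1 r| <= K & `|H2 r| <= K] by near: r.
have w0 := w_gt0 r0.
rewrite -[w r in leRHS](@lnK R) ?posrE // /M -expRD ler_expR -addrA.
have := ler_norm (T r); have := ler_norm (H r) => Hn Tn.
apply: lerD; first exact: le_trans Tr.
rewrite -(ler_pM2l Q0); apply: le_trans (E_le _) _.
by rewrite /L mulrDr addrC mulrCA divff ?gt_eqF // mulr1 lerD2r (le_trans Hn).
Unshelve. all: by end_near. Qed.

(** L' contains w'/w, and L'' contains w''/w and (w'/w)^2. Multiplication by S = O(w) removes one
    power of w, which leaves w'^2/w as the only term with a denominator. *)
Let N_le : \forall r \near (0 : R)^'+, `|N1 r| <= D1 * (1 + `|w1 r| / w r) /\
  `|N1 r ^+ 2 + N2 r| <= (2 * D1 ^+ 2 + D2) * (1 + (w1 r ^+ 2 / w r ^+ 2) + `|w2 r| / w r).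
Proof.
near=> r.
have r0 : 0 < r by near: r; exact: nbhs_right_gt.
have [_ Tr1 Tr2] : [/\ `|T r| <= K, `|T1 r| <= K & `|T2 r| <= K] by near: r.
have [_ Hr1 Hr2] : [/\ `|H r| <= K, `|H1 r| <= K & `|H2 r| <= K] by near: r.
have w0 := w_gt0 r0; have [Ec1 Ec2] := E_C (L r).
set a := `|w1 r| / w r; set b := `|w2 r| / w r.
have aE : `|w1 r / w r| = a by rewrite normrM normfV (gtr0_norm w0).
have bE : `|w2 r / w r| = b by rewrite normrM normfV (gtr0_norm w0).
have a0 : 0 <= a by rewrite -aE.
have b0 : 0 <= b by rewrite -bE.
have -> : w1 r ^+ 2 / w r ^+ 2 = a ^+ 2 by rewrite -aE -expr_div_n -normrX ger0_norm // sqr_ge0.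
have L1_le : `|L1 r| <= Q * a + K.
  by rewrite (le_trans (ler_normD _ _)) // lerD // normrM aE gtr0_norm.
have L2_le : `|L2 r| <= Q * (b + a ^+ 2) + K.
  rewrite (le_trans (ler_normD _ _)) // lerD // normrM (gtr0_norm Q0) ler_pM2l //.
  by rewrite (le_trans (ler_normB _ _)) // normrX aE bE.
have EL1 : `|E1 (L r) * L1 r| <= C * (Q * a + K) by rewrite normrM ler_pM.
have EL2 : `|E1 (L r) * L2 r| <= C * (Q * (b + a ^+ 2) + K) by rewrite normrM ler_pM.
have EL3 : `|E2 (L r) * L1 r ^+ 2| <= C * (Q * a + K) ^+ 2.
  have QaK : 0 <= Q * a + K by apply: addr_ge0; [apply: mulr_ge0 => //|]; exact: ltW.
  by rewrite normrM normrX ler_pM ?exprn_ge0 // lerXn2r.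
have CQ : 0 < C * Q by rewrite mulr_gt0.
have CK : 0 < C * K by rewrite mulr_gt0.
have CQ2 : 0 < C * Q ^+ 2 by rewrite mulr_gt0 // exprn_gt0.
have CK2 : 0 < C * K ^+ 2 by rewrite mulr_gt0 // exprn_gt0.
have D1_0 : 0 < D1 by rewrite /D1 !addr_gt0.
have N1_le : `|N1 r| <= D1 * (1 + a).
  rewrite (le_trans (ler_normD _ _)) //; apply: (le_trans (lerD Tr1 EL1)).
  rewrite /D1; have : 0 <= C * K * a by rewrite mulr_ge0 // ltW.
  have : 0 <= K * a by rewrite mulr_ge0 // ltW.
  lra.
split=> //.
(* The factor 2 is from (1 + a)^2 <= 2(1 + a^2). *)
have N1_sq : `|N1 r ^+ 2| <= 2 * D1 ^+ 2 * (1 + a ^+ 2).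
  apply: (@le_trans _ _ ((D1 * (1 + a)) ^+ 2)).
    rewrite normrX lerXn2r // nnegrE mulr_ge0 ?addr_ge0 //; exact: ltW.
  have -> : 2 * D1 ^+ 2 * (1 + a ^+ 2) = D1 ^+ 2 * (2 * (1 + a ^+ 2)) by ring.
  rewrite exprMn ler_wpM2l ?sqr_ge0 //.
  have := sqr_ge0 (1 - a); lra.
have N2_le : `|N2 r| <= D2 * (1 + a ^+ 2 + b).
  rewrite (le_trans (ler_normD _ _)) //.
  apply: (le_trans (lerD Tr2 (ler_normD _ _))).
  apply: (le_trans (lerD (lexx K) (lerD EL3 EL2))).
  have sq : C * (Q * a + K) ^+ 2 <= 2 * (C * Q ^+ 2) * a ^+ 2 + 2 * (C * K ^+ 2).
    have := mulr_ge0 (ltW C0) (sqr_ge0 (Q * a - K)); lra.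
  have a2 : 0 <= a ^+ 2 by exact: sqr_ge0.
  have := mulr_ge0 (ltW K0) a2; have := mulr_ge0 (ltW K0) b0.
  have := mulr_ge0 (ltW CQ2) b0; have := mulr_ge0 (ltW CK2) b0; have := mulr_ge0 (ltW CK2) a2.
  have := mulr_ge0 (ltW CK) b0; have := mulr_ge0 (ltW CK) a2.
  rewrite /D2; lra.
rewrite (le_trans (ler_normD _ _)) // mulrDl; apply: (le_trans (lerD N1_sq N2_le)).
rewrite lerD2r ler_wpM2l ?mulr_ge0 ?sqr_ge0 //; lra.
Unshelve. all: by end_near. Qed.

Lemma profile_vanishing : exists S1 S2 : R -> R,
  [/\ forall r : R, 0 < r -> is_derive r 1 S (S1 r),
      forall r : R, 0 < r -> is_derive r 1 S1 (S2 r),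
      S r @[r --> (0 : R)^'+] --> 0,
      S1 r @[r --> (0 : R)^'+] --> 0 &
      S2 r @[r --> (0 : R)^'+] --> 0].
Proof.
exists (fun r => S r * N1 r), (fun r => S r * (N1 r ^+ 2 + N2 r)); split=> //.
- apply: (@cvg0_le _ w M) => //.
  by apply: filterS S_le => r [_ Sr]; rewrite ger0_norm // expR_ge0.
- apply: (@cvg0_le _ (fun r => w r + `|w1 r|) (M * D1)).
    apply: filterS2 S_le N_le => r [r0 Sr] [Nr _].
    have w0 := w_gt0 r0.
    have -> : M * D1 * (w r + `|w1 r|) = M * w r * (D1 * (1 + `|w1 r| / w r)).
      by field; rewrite gt_eqF.
    by rewrite normrM ler_pM // ger0_norm // expR_ge0.
  by have := cvgD w_0 (cvg_norm w1_0); rewrite normr0 addr0; exact.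
- apply: (@cvg0_le _ (fun r => w r + w1 r ^+ 2 / w r + `|w2 r|) (M * (2 * D1 ^+ 2 + D2))).
    apply: filterS2 S_le N_le => r [r0 Sr] [_ Nr].
    have w0 := w_gt0 r0.
    have -> : M * (2 * D1 ^+ 2 + D2) * (w r + w1 r ^+ 2 / w r + `|w2 r|) =
      M * w r * ((2 * D1 ^+ 2 + D2) * (1 + w1 r ^+ 2 / w r ^+ 2 + `|w2 r| / w r)).
      by field; rewrite gt_eqF.
    by rewrite normrM ler_pM // ger0_norm // expR_ge0.
  have W := sqr_derive_div_cvg0 dw dw1 w_gt0 w1_0 w2_0.
  by have := cvgD (cvgD w_0 W) (cvg_norm w2_0); rewrite normr0 !addr0; exact.
Qed.

End Profile.

(** * Radial geometry of space *)

Section Space.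
Variable R : realType.
Local Notation V := 'cV[R]_3.
Implicit Types (x y v w : V) (i j : 'I_3) (e d : R).

(** [Ckon] supplies some witness for the derivative; by uniqueness its regularity passes to any
    prescribed formula [df]. *)
Lemma Ckon_derive (W : normedModType R) (A : set W) k (f df : W -> R) (v : W) :
  open A -> Ckon A k.+1 f -> (forall z : W, A z -> is_derive z v f (df z)) -> Ckon A k df.
Proof.
move=> oA [_ fd] dfE; have [g gE Hg] := fd v.
apply: Ckon_eq Hg => // z Az.
by have [_ <-] := gE _ Az; have [_ <-] := dfE _ Az.
Qed.

Definition dot x y : R := \sum_i x i 0 * y i 0.

Lemma dotC x y : dot x y = dot y x.
Proof. by apply: eq_bigr => i _; rewrite mulrC. Qed.

Lemma dot_linl h v x y : dot (h *: v + x) y = h * dot v y + dot x y.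
Proof.
rewrite mulr_sumr -big_split /=; apply: eq_bigr => i _.
by rewrite !mxE mulrDl mulrA.
Qed.

Lemma dot_basis3 x i : dot x (basis3 R i) = x i 0.
Proof.
rewrite /dot (bigD1 i) //= big1 => [|j ji]; rewrite !mxE ?eqxx ?mulr1 ?addr0 //.
by rewrite (negbTE ji) mulr0.
Qed.

Lemma basis3E i j : basis3 R i j 0 = (j == i)%:R.
Proof. by rewrite mxE eqxx andbT. Qed.

Lemma enormE x : enorm x = Num.sqrt (dot x x).
Proof. by congr Num.sqrt; apply: eq_bigr => i _; rewrite expr2. Qed.

Lemma dot_ge0 x : 0 <= dot x x.
Proof. by apply: sumr_ge0 => i _; rewrite -expr2 sqr_ge0. Qed.

Lemma sqr_enorm x : enorm x ^+ 2 = dot x x.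
Proof. by rewrite enormE sqr_sqrtr // dot_ge0. Qed.

Lemma enorm_ge0 x : 0 <= enorm x. Proof. exact: sqrtr_ge0. Qed.

Lemma enorm0 : enorm (0 : V) = 0.
Proof. by rewrite enormE /dot big1 ?sqrtr0 // => i _; rewrite mxE mul0r. Qed.

Lemma coord_le_enorm x i : `|x i 0| <= enorm x.
Proof.
rewrite -(@ler_pXn2r _ 2) ?nnegrE ?enorm_ge0 // real_normK ?num_real // sqr_enorm.
rewrite /dot (bigD1 i) //= expr2 lerDl; apply: sumr_ge0 => j _.
by rewrite -expr2 sqr_ge0.
Qed.

Lemma enorm_gt0 x : x != 0 -> 0 < enorm x.
Proof.
move=> x0; rewrite lt_neqAle enorm_ge0 andbT eq_sym; apply: contra x0 => /eqP e0.
apply/eqP/colP => i; rewrite mxE; apply/eqP; rewrite -normr_le0 -e0.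
exact: coord_le_enorm.
Qed.

Lemma enormZ h x : enorm (h *: x) = `|h| * enorm x.
Proof.
rewrite !enormE (_ : dot _ _ = h ^+ 2 * dot x x).
  by rewrite sqrtrM ?sqr_ge0 // sqrtr_sqr.
by rewrite mulr_sumr; apply: eq_bigr => i _; rewrite !mxE; ring.
Qed.

(** The l^1 norm: it bounds [dot] coordinate by coordinate, and for fixed directions any constant
    will do. *)
Definition bnd v : R := \sum_i `|v i 0|.

Lemma bnd_ge0 v : 0 <= bnd v. Proof. exact: sumr_ge0. Qed.

Lemma dot_le x v : `|dot x v| <= enorm x * bnd v.
Proof.
rewrite mulr_sumr (le_trans (ler_norm_sum _ _ _)) //; apply: ler_sum => i _.
by rewrite normrM ler_wpM2r // coord_le_enorm.
Qed.

(** The component of x/|x| along v, which is also the derivative of the norm along v. The convention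
    that 0 has inverse 0 makes it vanish at the origin. *)
Definition dir v x := dot x v / enorm x.

Lemma dir0 v : dir v 0 = 0.
Proof. by rewrite /dir enorm0 invr0 mulr0. Qed.

Lemma dir_le v x : `|dir v x| <= bnd v.
Proof.
have [->|x0] := eqVneq x 0; first by rewrite dir0 normr0 bnd_ge0.
have r0 := enorm_gt0 x0.
by rewrite normrM normfV (gtr0_norm r0) ler_pdivrMr // mulrC dot_le.
Qed.

Lemma Ckon_coord A k i : Ckon A k (fun x => x i 0).
Proof.
apply: (@Ckon_lin _ _ _ _ _ (fun v => v i 0)); first by move=> *; rewrite !mxE.
exact: coord_continuous.
Qed.

Lemma Ckon_dot A k v : Ckon A k (dot^~ v).
Proof.
by apply: Ckon_sum => i; apply: CkonM; [exact: Ckon_coord|exact: Ckon_cst].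
Qed.

Lemma Ckon_sqr_enorm A k : Ckon A k (fun x => dot x x).
Proof. by apply: Ckon_sum => i; apply: CkonM; exact: Ckon_coord. Qed.

Lemma Ckon_enorm k : Ckon [set x | x != 0] k (@enorm R).
Proof.
rewrite (_ : @enorm R = fun x => Num.sqrt (dot x x)); last first.
  by apply/funext => x; rewrite enormE.
apply: Ckon_comp_sqrt; first exact: Ckon_sqr_enorm.
by move=> x /= /enorm_gt0; rewrite enormE sqrtr_gt0.
Qed.

Lemma Ckon_enormV k : Ckon [set x | x != 0] k (fun x : V => (enorm x)^-1).
Proof.
apply: Ckon_comp_inv; first exact: Ckon_enorm.
by move=> x /= /enorm_gt0 /lt0r_neq0.
Qed.

Lemma Ckon_dir k v : Ckon [set x | x != 0] k (dir v).
Proof. by apply: CkonM; [exact: Ckon_dot|exact: Ckon_enormV]. Qed.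

Lemma is_derive_dot x w v : is_derive x w (dot^~ v) (dot w v).
Proof.
apply/is_derive_line; under eq_fun do rewrite dot_linl.
by apply: is_derive_eq; rewrite /GRing.scale /=; ring.
Qed.

Lemma is_derive_sqr_enorm x w : is_derive x w (fun x => dot x x) (2 * dot x w).
Proof.
apply/is_derive_line.
have -> : (fun h => dot (h *: w + x) (h *: w + x)) =
    (fun h => h * (h * dot w w) + h * (2 * dot x w) + dot x x).
  by apply/funext => h; rewrite dot_linl dotC dot_linl [dot x (_ + _)]dotC dot_linl
    (dotC w x); ring.
by apply: is_derive_eq; rewrite /GRing.scale /=; ring.
Qed.

Lemma is_derive_enorm x w : x != 0 -> is_derive x w (@enorm R) (dir w x).
Proof.
move=> x0; have r0 := enorm_gt0 x0.
have r2 : 0 < dot x x by rewrite -sqr_enorm exprn_gt0.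
have dd := is_derive_sqr_enorm x w.
rewrite (_ : @enorm R = fun x => Num.sqrt (dot x x)); last first.
  by apply/funext => y; rewrite enormE.
rewrite /dir enormE.
have -> : dot x w / Num.sqrt (dot x x) = (2 * Num.sqrt (dot x x))^-1 * (2 * dot x w).
  by field; rewrite -enormE gt_eqF.
exact: (is_derive_chain dd (is_derive1_sqrt r2)).
Qed.

Lemma is_derive_dir x w v : x != 0 ->
  is_derive x w (dir v) ((dot w v - dir v x * dir w x) / enorm x).
Proof.
move=> x0; have r0 : enorm x != 0 by rewrite gt_eqF ?enorm_gt0.
have ? := is_derive_dot x w v; have de := is_derive_enorm w x0.
have ? := is_derive_chain de (@is_deriveV R id _ _ _ r0 (is_derive_id (enorm x) 1)).
by apply: is_derive_eq; rewrite /dir /GRing.scale /=; field.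
Qed.

End Space.

(** * Removing a singularity at the origin *)

Section Removable.
Variable R : realType.
Local Notation V := 'cV[R]_3.
Implicit Types (x y v w : V) (i j : 'I_3) (e d : R).

Lemma near0_enorm d : 0 < d -> \forall x \near (0 : V), enorm x < d.
Proof.
move=> d0; have c : {for 0, continuous (@enorm R)}.
  rewrite (_ : @enorm R = fun x => Num.sqrt (dot x x)); last first.
    by apply/funext => y; rewrite enormE.
  apply: (@continuous_comp _ _ _ (fun x : V => dot x x) Num.sqrt).
    by apply: (@Ckon_continuous _ _ setT 0) => //; exact: Ckon_sqr_enorm.
  exact: sqrt_continuous.
have /cvgrPdist_lt/(_ _ d0) := c.
by apply: filterS => x; rewrite enorm0 sub0r normrN ger0_norm ?enorm_ge0.
Qed.

(** This is f = o(|x|^n) at the origin, with the value at 0 left out. *)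
Definition vanishing (n : nat) (f : V -> R) := forall e, 0 < e ->
  exists2 d, 0 < d & forall x, x != 0 -> enorm x < d -> `|f x| <= e * enorm x ^+ n.

Lemma vanishingW (n : nat) (f : V -> R) : vanishing n.+1 f -> vanishing n f.
Proof.
move=> fv e e0; have [d d0 H] := fv e e0; exists (Num.min d 1); first by rewrite lt_min d0 ltr01.
move=> x x0; rewrite lt_min => /andP[xd x1]; apply: le_trans (H _ x0 xd) _.
have r0 := enorm_gt0 x0.
by rewrite ler_pM2l // exprSr ler_piMr ?exprn_ge0 // ltW.
Qed.

Lemma continuous_vanishing (f : V -> R) :
  f 0 = 0 -> vanishing 0 f -> {for 0, continuous f}.
Proof.
move=> f0 fv; apply: (@cvgrPdist_le _ _ _ _ (nbhs_filter (0 : V)) f (f 0)).2.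
move=> e e0; have [d d0 H] := fv _ e0.
apply: filterS (near0_enorm d0) => x xd; rewrite f0 sub0r normrN.
have [->|x0] := eqVneq x 0; first by rewrite f0 normr0 ltW.
by have := H _ x0 xd; rewrite mulr1.
Qed.

Lemma is_derive_vanishing (f : V -> R) v :
  f 0 = 0 -> vanishing 1 f -> is_derive 0 v f 0.
Proof.
move=> f0 fv.
have : h^-1 *: ((f \o shift 0) (h *: v) - f 0) @[h --> (0 : R)^'] --> 0.
  apply/cvgrPdist_le => e e0.
  (* The added 1 keeps the divisor positive when v = 0. *)
  have N0 : 0 < enorm v + 1 by rewrite ltr_wpDl ?enorm_ge0.
  have [d d0 H] := fv (e / (enorm v + 1)) (divr_gt0 e0 N0).
  have d1 : 0 < d / (enorm v + 1) by rewrite divr_gt0.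
  exists (d / (enorm v + 1)) => //= h /=; rewrite sub0r normrN => hd h0.
  rewrite sub0r normrN f0 subr0 addr0.
  have [->|v0] := eqVneq v 0; first by rewrite scaler0 f0 scaler0 normr0 ltW.
  have hn : 0 < `|h| by rewrite normr_gt0.
  have hv : h *: v != 0 by rewrite scaler_eq0 negb_or h0.
  have hvd : enorm (h *: v) < d.
    rewrite enormZ; move: hd; rewrite ltr_pdivlMr // => /le_lt_trans; apply.
    by rewrite ler_pM2l // lerDl.
  rewrite normrZ normfV ler_pdivrMl //; apply: le_trans (H _ hv hvd) _.
  rewrite expr1 enormZ mulrCA ler_pM2l // -mulrA ger_pMr //.
  by rewrite mulrC ler_pdivrMr // mul1r lerDl.
move=> /[dup] /cvgP df /cvg_lim dE; apply: DeriveDef => //; exact: dE.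
Qed.

(** At the origin an o(|x|) bound on [f] and on [D v] gives them zero derivatives there, which agree
    with the prescribed values of [D] and [DD]; the o(1) bound on [DD] then yields continuity of the
    second derivatives. *)
Lemma Ckon2_removable (f : V -> R) (D : V -> V -> R) (DD : V -> V -> V -> R) :
  (forall x, x != 0 -> {for x, continuous f}) ->
  (forall v x, x != 0 -> is_derive x v f (D v x)) ->
  (forall v w x, x != 0 -> is_derive x w (D v) (DD v w x)) ->
  (forall v x, x != 0 -> {for x, continuous (D v)}) ->
  (forall v w x, x != 0 -> {for x, continuous (DD v w)}) ->
  f 0 = 0 -> (forall v, D v 0 = 0) -> (forall v w, DD v w 0 = 0) ->
  vanishing 1 f -> (forall v, vanishing 1 (D v)) ->
  (forall v w, vanishing 0 (DD v w)) ->
  Ckon setT 2 f /\ forall v x, is_derive x v f (D v x).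
Proof.
move=> fc fD DD' Dc DDc f0 D0 DD0 fv Dv DDv.
have fD' v x : is_derive x v f (D v x).
  have [->|] := eqVneq x 0; last exact: fD.
  by rewrite D0; exact: is_derive_vanishing.
split=> //; split=> [x _|v].
  have [->|] := eqVneq x 0; last exact: fc.
  by apply: continuous_vanishing => //; exact: vanishingW.
exists (D v) => //; split=> [x _|w].
  have [->|] := eqVneq x 0; last exact: Dc.
  by apply: continuous_vanishing => //; exact: vanishingW.
exists (DD v w); last first.
  split=> // x _; have [->|] := eqVneq x 0; last exact: DDc.
  exact: continuous_vanishing.
move=> x _; have [->|] := eqVneq x 0; last exact: DD'.
by rewrite DD0; exact: is_derive_vanishing.
Qed.

End Removable.

(** * The radial field S(|x|) x/|x| on space *)

Section RadialField.
Variable R : realType.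
Local Notation V := 'cV[R]_3.
Implicit Types (x y v w : V) (i j : 'I_3) (e d : R).
Variables S S1 S2 : R -> R.
Let pos : set R := [set r | 0 < r].
Hypothesis S_C2 : Ckon pos 2 S.
Hypothesis dS : forall r : R, 0 < r -> is_derive r 1 S (S1 r).
Hypothesis dS1 : forall r : R, 0 < r -> is_derive r 1 S1 (S2 r).
Hypothesis S_0 : S r @[r --> (0 : R)^'+] --> 0.
Hypothesis S1_0 : S1 r @[r --> (0 : R)^'+] --> 0.
Hypothesis S2_0 : S2 r @[r --> (0 : R)^'+] --> 0.

Let pos_open : open pos. Proof. exact: open_gt. Qed.

Let S1_C1 : Ckon pos 1 S1.
Proof. by apply: (Ckon_derive pos_open S_C2) => r; exact: dS. Qed.

Let S2_C0 : Ckon pos 0 S2.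
Proof. by apply: (Ckon_derive pos_open S1_C1) => r; exact: dS1. Qed.

(** Two integrations from 0 turn S'' = o(1) into S' = o(r) and S = o(r^2). *)
Let S_small e : 0 < e -> exists2 d, 0 < d & forall r, 0 < r -> r < d ->
  [/\ `|S r| <= e * r ^+ 2, `|S1 r| <= e * r & `|S2 r| <= e].
Proof.
move=> e0; have e2 : 0 < e / 2 by rewrite divr_gt0.
have /cvgrPdist_le/(_ _ e2)/near_at_right0[d d0 H] := S2_0.
have {}H r : 0 < r -> r < d -> `|S2 r| <= e / 2.
  by move=> r0 rd; have := H r r0 rd; rewrite sub0r normrN.
have H1 := le_of_derive_right0 dS1 H S1_0.
exists (d / 2); first by rewrite divr_gt0.
move=> r r0 rd; split.
(* The second integration needs a constant bound on S' over an interval reaching past r; (0, 2r) is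
   taken, where (e/2) s <= e r. Halving [d] keeps 2r below it. *)
- have H2 s : 0 < s -> s < 2 * r -> `|S1 s| <= e * r.
    move=> s0 sr; apply: le_trans (H1 s s0 _) _; first lra.
    have -> : e * r = e / 2 * (2 * r) by field.
    by rewrite ler_pM2l // ltW.
  rewrite expr2 mulrA; apply: (le_of_derive_right0 dS H2 S_0) => //; lra.
- apply: le_trans (H1 r r0 _) _; first lra.
  by rewrite ler_pM2r //; lra.
- by apply: le_trans (H r r0 _) _; lra.
Qed.

Definition field_comp i x := S (enorm x) * dir (basis3 R i) x.

(** The Jacobian splits into S' - S/r times the projection on the radial direction, plus S/r times
    the identity. *)
Definition field_deriv i v x :=
  (S1 (enorm x) - S (enorm x) / enorm x) * (dir v x * dir (basis3 R i) x)
  + S (enorm x) / enorm x * v i 0.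

(** Since (S/r)' = (S' - S/r)/r, the profile enters only through S'' and (S' - S/r)/r, both o(1). *)
Let field_deriv2 i v w x :=
  let r := enorm x in let b := dir (basis3 R i) x in
  (S2 r - (S1 r - S r / r) / r) * dir w x * (dir v x * b)
  + (S1 r - S r / r) * ((dot w v - dir v x * dir w x) / r * b
                        + dir v x * ((w i 0 - b * dir w x) / r))
  + (S1 r - S r / r) / r * dir w x * v i 0.

Let is_derive_comp i v x : x != 0 -> is_derive x v (field_comp i) (field_deriv i v x).
Proof.
move=> x0; have r0 := enorm_gt0 x0.
have ? := is_derive_chain (is_derive_enorm v x0) (dS r0).
have ? := is_derive_dir v (basis3 R i) x0.
apply: is_derive_eq; rewrite /field_deriv dot_basis3 /GRing.scale /=; field.
by rewrite gt_eqF.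
Qed.

Let is_derive_deriv i v w x : x != 0 ->
  is_derive x w (field_deriv i v) (field_deriv2 i v w x).
Proof.
move=> x0; have r0 := enorm_gt0 x0; have rn : enorm x != 0 by rewrite gt_eqF.
have de := is_derive_enorm w x0.
have ? := is_derive_chain de (dS r0).
have ? := is_derive_chain de (dS1 r0).
have ? := is_derive_chain de (@is_deriveV R id _ _ _ rn (is_derive_id (enorm x) 1)).
have ? := is_derive_dir w (basis3 R i) x0.
have ? := is_derive_dir w v x0.
apply: is_derive_eq; rewrite /field_deriv2 dot_basis3 /GRing.scale /=; field.
exact: rn.
Qed.

Let nz : set V := [set x | x != 0].

Let CS k (F : R -> R) : Ckon pos k F -> Ckon nz k (fun x => F (enorm x)).
Proof.
by apply: (@Ckon_comp _ _ _ pos); [exact: enorm_gt0|exact: Ckon_enorm].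
Qed.

Let C_comp i : Ckon nz 0 (field_comp i).
Proof.
by apply: CkonM; [apply: CS; apply: Ckon_le S_C2|exact: Ckon_dir].
Qed.

Let CA : Ckon nz 0 (fun x => S (enorm x) / enorm x).
Proof.
by apply: CkonM; [apply: CS; apply: Ckon_le S_C2|exact: Ckon_enormV].
Qed.

Let CB : Ckon nz 0 (fun x => S1 (enorm x) - S (enorm x) / enorm x).
Proof. by apply: CkonB; [apply: CS; apply: Ckon_le S1_C1|exact: CA]. Qed.

Let C_deriv i v : Ckon nz 0 (field_deriv i v).
Proof.
apply: CkonD; apply: CkonM => //; last exact: Ckon_cst.
by apply: CkonM; exact: Ckon_dir.
Qed.

Let C_deriv2 i v w : Ckon nz 0 (field_deriv2 i v w).
Proof.
have C u := Ckon_dir 0 u.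
have Cb u v' k' : Ckon nz 0 (fun x => (dot u v' - dir k' x * dir u x) / enorm x).
  by apply: CkonM; [apply: CkonB; [exact: Ckon_cst|exact: CkonM]|exact: Ckon_enormV].
have CBr : Ckon nz 0 (fun x => (S1 (enorm x) - S (enorm x) / enorm x) / enorm x).
  by apply: CkonM => //; exact: Ckon_enormV.
apply: CkonD; first apply: CkonD.
- apply: CkonM; last exact: CkonM.
  by apply: CkonM => //; apply: CkonB => //; exact: CS.
- apply: CkonM => //; apply: CkonD; first by apply: CkonM.
  apply: CkonM => //; have := Cb w (basis3 R i) (basis3 R i).
  by rewrite dot_basis3.
- by apply: CkonM; [exact: CkonM|exact: Ckon_cst].
Qed.

(** Applying [S_small] with e / C absorbs any constant that depends on the directions only. *)
Let small_radial (n : nat) (f : V -> R) (C : R) : 0 < C ->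
  (forall e x, 0 < e -> x != 0 -> enorm x < 1 ->
     `|S (enorm x)| <= e * enorm x ^+ 2 -> `|S1 (enorm x)| <= e * enorm x ->
     `|S2 (enorm x)| <= e -> `|f x| <= C * e * enorm x ^+ n) ->
  vanishing n f.
Proof.
move=> C0 H e e0; have [d d0 Hd] := S_small (divr_gt0 e0 C0).
exists (Num.min d 1); first by rewrite lt_min d0 ltr01.
move=> x x0; rewrite lt_min => /andP[xd x1].
have [h0 h1 h2] := Hd _ (enorm_gt0 x0) xd.
have := H _ x (divr_gt0 e0 C0) x0 x1 h0 h1 h2.
by rewrite mulrCA divff ?gt_eqF // mulr1.
Qed.

Let A_le e x : x != 0 -> `|S (enorm x)| <= e * enorm x ^+ 2 ->
  `|S (enorm x) / enorm x| <= e * enorm x.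
Proof.
move=> /enorm_gt0 r0 h.
by rewrite normrM normfV (gtr0_norm r0) ler_pdivrMr // -mulrA -expr2.
Qed.

Let B_le e x : x != 0 -> `|S (enorm x)| <= e * enorm x ^+ 2 ->
  `|S1 (enorm x)| <= e * enorm x ->
  `|S1 (enorm x) - S (enorm x) / enorm x| <= 2 * e * enorm x.
Proof.
move=> x0 /(A_le x0) h0 h1.
rewrite (le_trans (ler_normB _ _)) //; lra.
Qed.

Let v_comp : forall i, vanishing 1 (field_comp i).
Proof.
move=> i; apply: vanishingW; apply: (@small_radial _ _ (bnd (basis3 R i) + 1)).
  by rewrite ltr_wpDl ?bnd_ge0.
move=> e x e0 x0 x1 h0 _ _; have r0 := enorm_gt0 x0.
rewrite normrM -mulrA mulrC ler_pM //.
by rewrite (le_trans (dir_le _ _)) // lerDl.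
Qed.

Let v_deriv i v : vanishing 1 (field_deriv i v).
Proof.
pose b := bnd (basis3 R i).
have b0 : 0 <= b by exact: bnd_ge0.
have bv0 : 0 <= bnd v by exact: bnd_ge0.
apply: (@small_radial _ _ (2 * (bnd v * b) + `|v i 0| + 1)).
  by rewrite ltr_wpDl // addr_ge0 // mulr_ge0 // mulr_ge0.
move=> e x e0 x0 x1 h0 h1 _; have r0 := enorm_gt0 x0.
have er : 0 < e * enorm x by rewrite mulr_gt0.
have t1 : `|(S1 (enorm x) - S (enorm x) / enorm x) * (dir v x * dir (basis3 R i) x)|
    <= 2 * e * enorm x * (bnd v * b).
  by rewrite normrM ler_pM // ?B_le // normrM ler_pM // dir_le.
have t2 : `|S (enorm x) / enorm x * v i 0| <= e * enorm x * `|v i 0|.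
  by rewrite normrM ler_wpM2r // A_le.
rewrite (le_trans (ler_normD _ _)) // expr1; apply: (le_trans (lerD t1 t2)).
lra.
Qed.

Let v_deriv2 i v w : vanishing 0 (field_deriv2 i v w).
Proof.
pose b := bnd (basis3 R i).
have b0 : 0 <= b by exact: bnd_ge0.
have bv0 : 0 <= bnd v by exact: bnd_ge0.
have bw0 : 0 <= bnd w by exact: bnd_ge0.
(* One line per term of [field_deriv2], with B = S' - S/r: the 3 bounds |S''| + |B/r| <= e + 2e, the
   2 bounds |B/r| <= 2e. *)
pose c := 3 * (bnd w * (bnd v * b))
  + 2 * ((`|dot w v| + bnd v * bnd w) * b + bnd v * (`|w i 0| + b * bnd w))
  + 2 * (bnd w * `|v i 0|).
have c0 : 0 <= c.
  by rewrite /c !addr_ge0 // ?mulr_ge0 // ?addr_ge0 // ?mulr_ge0 // ?addr_ge0 // ?mulr_ge0.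
apply: (@small_radial _ _ (c + 1)); first by rewrite ltr_wpDl.
move=> e x e0 x0 x1 h0 h1 h2; have r0 := enorm_gt0 x0.
have HB := B_le x0 h0 h1.
rewrite /field_deriv2 /=; set B := S1 _ - _ in HB *.
set bi := dir (basis3 R i) x.
have bib : `|bi| <= b by exact: dir_le.
have dv : `|dir v x| <= bnd v by exact: dir_le.
have dw : `|dir w x| <= bnd w by exact: dir_le.
have HBr : `|B / enorm x| <= 2 * e.
  by rewrite normrM normfV (gtr0_norm r0) ler_pdivrMr.
have t1 : `|(S2 (enorm x) - B / enorm x) * dir w x * (dir v x * bi)|
    <= 3 * e * (bnd w * (bnd v * b)).
  rewrite -mulrA normrM ler_pM //.
    rewrite (le_trans (ler_normB _ _)) //; lra.
  by rewrite normrM ler_pM // normrM ler_pM.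
have t2 : `|B * ((dot w v - dir v x * dir w x) / enorm x * bi +
      dir v x * ((w i 0 - bi * dir w x) / enorm x))| <=
    2 * e * ((`|dot w v| + bnd v * bnd w) * b + bnd v * (`|w i 0| + b * bnd w)).
  (* The denominators 1/r from differentiating [dir] are moved onto B, where B/r is small. *)
  have -> : B * ((dot w v - dir v x * dir w x) / enorm x * bi +
      dir v x * ((w i 0 - bi * dir w x) / enorm x)) =
      B / enorm x * ((dot w v - dir v x * dir w x) * bi +
      dir v x * (w i 0 - bi * dir w x)) by field; rewrite gt_eqF.
  rewrite normrM ler_pM // (le_trans (ler_normD _ _)) // lerD //.
    rewrite normrM ler_pM // (le_trans (ler_normB _ _)) // lerD // normrM ler_pM //.
  by rewrite normrM ler_pM // (le_trans (ler_normB _ _)) // lerD // normrM ler_pM.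
have t3 : `|B / enorm x * dir w x * v i 0| <= 2 * e * (bnd w * `|v i 0|).
  by rewrite -mulrA normrM ler_pM // normrM ler_pM.
rewrite (le_trans (ler_normD _ _)) // expr0 mulr1.
apply: (le_trans (lerD (le_trans (ler_normD _ _) (lerD t1 t2)) t3)).
rewrite /c; lra.
Qed.

Let enormV0 : S (enorm (0 : V)) / enorm (0 : V) = 0.
Proof. by rewrite enorm0 invr0 mulr0. Qed.

Lemma field_comp0 i : field_comp i 0 = 0.
Proof. by rewrite /field_comp dir0 mulr0. Qed.

Lemma field_comp_C2 i : Ckon setT 2 (field_comp i) /\
  forall v x, is_derive x v (field_comp i) (field_deriv i v x).
Proof.
have D0 v : field_deriv i v 0 = 0.
  by rewrite /field_deriv enormV0 !dir0 mulr0 mulr0 mul0r addr0.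
have DD0 v w : field_deriv2 i v w 0 = 0.
  by rewrite /field_deriv2 /= !dir0 enorm0 invr0; ring.
exact: (Ckon2_removable
  (fun x => @Ckon_continuous _ _ _ _ _ x (C_comp i)) (@is_derive_comp i) (@is_derive_deriv i)
  (fun v x => @Ckon_continuous _ _ _ _ _ x (C_deriv i v))
  (fun v w x => @Ckon_continuous _ _ _ _ _ x (C_deriv2 i v w))
  (field_comp0 i) D0 DD0 (v_comp i) (v_deriv i) (v_deriv2 i)).
Qed.

(** A symmetric Jacobian means a curl-free field. *)
Lemma field_deriv_sym i j x :
  field_deriv i (basis3 R j) x = field_deriv j (basis3 R i) x.
Proof.
by rewrite /field_deriv !basis3E [_ == j]eq_sym [dir _ _ * dir _ _]mulrC.
Qed.

End RadialField.

(** * The radial profile *)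

Lemma Ckon_is_derive (R : realType) (V : normedModType R) (A : set V) k (f : V -> R) (x v : V) :
  Ckon A k.+1 f -> A x -> is_derive x v f ('D_v f x).
Proof.
move=> [_ fd] Ax; have [df dfE _] := fd v; have d := dfE _ Ax.
by apply: derivableP; case: d.
Qed.

Section Line.
Variable R : realType.
Local Notation V := 'cV[R]_3.
Implicit Types (e : V) (f : V -> R).

Lemma derive_line e f (t : R) : 'D_1 (fun t : R => f (t *: e)) t = 'D_e f (t *: e).
Proof.
rewrite /derive; set g1 := fun h => h^-1 *: _; set g2 := fun h => h^-1 *: _.
suff -> : g1 = g2 by [].
by rewrite funeqE /g1 /g2 => h /=; rewrite scalerDl [h *: 1]mulr1.
Qed.

Lemma Ck_line k e f : Ck k f -> Ckon setT k (fun t : R => f (t *: e)).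
Proof.
move=> /Ck_Ckon Hf.
apply: (@Ckon_affine _ R _ setT _ f (fun t => t *: e) (fun v => v *: e)) => //.
  by move=> x h v; rewrite scalerDl scalerA.
exact: scalel_continuous.
Qed.

Lemma cvg_line e f (l : R) : e != 0 ->
  f x @[x --> (0 : V)^'] --> l -> f (t *: e) @[t --> (0 : R)^'+] --> l.
Proof.
move=> e0 fl.
suff te : t *: e @[t --> (0 : R)^'+] --> (0 : V)^' by exact: cvg_comp te fl.
move=> A nA.
have c : t *: e @[t --> (0 : R)] --> (0 : V).
  by have := @scalel_continuous R V e 0; rewrite /continuous_at scale0r.
have B : \forall t \near (0 : R), t *: e != 0 -> A (t *: e) by exact: (c _ nA).
apply: filterS B => t At t0.
by apply: At; rewrite scaler_eq0 negb_or e0 andbT gt_eqF.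
Qed.

End Line.

(** * The profile on the half-line and its exponential decay *)

Section ProfileData.
Variables (R : realType) (P Q gamma c3 c4 : R) (sg ta : R -> R).
Hypotheses (P0 : 0 < P) (PQ : P < Q) (gamma_gt0 : 0 < gamma) (c3_gt0 : 0 < c3).
Hypotheses (sg_C2 : Ckon setT 2 sg) (ta_C2 : Ckon setT 2 ta).
Hypotheses (sg_gt0 : forall t, 0 < sg t) (ta_gt0 : forall t : R, 0 < ta t).
Hypothesis sg_lt1 : forall t : R, 0 < t -> sg t < 1.
Let w t := `|1 - sg t| `^ Q^-1.
Hypothesis w_0 : w t @[t --> (0 : R)^'+] --> 0.
Hypothesis w1_0 : 'D_1 w t @[t --> (0 : R)^'+] --> 0.
Hypothesis w2_0 : 'D_1 ('D_1 w) t @[t --> (0 : R)^'+] --> 0.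
Hypothesis decay : forall t : R, 0 < t -> 1 - sg t <= c3 * expR (- (gamma * Q * t)).
Hypothesis ta_le : forall t, ta t <= c4.

Let Q0 : 0 < Q. Proof. exact: lt_trans PQ. Qed.
Let pos : set R := [set r | 0 < r].
Let pos_open : open pos. Proof. exact: open_gt. Qed.

Let wE t : 0 < t -> w t = (1 - sg t) `^ Q^-1.
Proof. by move=> t0; rewrite /w ger0_norm // subr_ge0 ltW ?sg_lt1. Qed.

Let w_gt0 t : 0 < t -> 0 < w t.
Proof. by move=> t0; rewrite wE // powR_gt0 // subr_gt0 sg_lt1. Qed.

Let w_C2 : Ckon pos 2 w.
Proof.
apply: (@Ckon_eq _ _ _ _ (fun t => (1 - sg t) `^ Q^-1)) => //.
  by move=> t t0; rewrite wE.
apply: Ckon_comp_powR; last by move=> t t0; rewrite subr_gt0 sg_lt1.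
by apply: CkonB; [exact: Ckon_cst|apply: Ckon_sub sg_C2].
Qed.

Let w1_C1 : Ckon pos 1 ('D_1 w).
Proof. by apply: (Ckon_derive pos_open w_C2) => r; exact: (Ckon_is_derive _ w_C2). Qed.

Let T t := ln (ta t).
(** What is left of sigma^(-2) - 1 = (1 - sigma)(1 + sigma)/sigma^2 once w^Q = 1 - sigma is taken
    out. The argument is positive and C^2 across 0, so two derivatives of [H] are bounded near 0. *)
Let H t := ln ((1 + sg t) / sg t ^+ 2).

Let T_C2 : Ckon setT 2 T.
Proof. exact: Ckon_comp_ln. Qed.

Let H_arg_gt0 t : 0 < (1 + sg t) / sg t ^+ 2.
Proof. by rewrite divr_gt0 ?exprn_gt0 // addr_gt0. Qed.

Let H_C2 : Ckon setT 2 H.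
Proof.
apply: Ckon_comp_ln; last by move=> x _; exact: H_arg_gt0.
apply: CkonM; first by apply: CkonD => //; exact: Ckon_cst.
apply: Ckon_comp_inv; last by move=> x _; rewrite gt_eqF // exprn_gt0.
exact: CkonM.
Qed.

Let bounded_C2 (F : R -> R) : Ckon setT 2 F -> exists2 K, 0 < K &
  \forall r \near (0 : R)^'+, [/\ `|F r| <= K, `|'D_1 F r| <= K & `|'D_1 ('D_1 F) r| <= K].
Proof.
move=> F2.
have F1 : Ckon setT 1 ('D_1 F).
  by apply: (Ckon_derive openT F2) => r; exact: (Ckon_is_derive _ F2).
have F0 : Ckon setT 0 ('D_1 ('D_1 F)).
  by apply: (Ckon_derive openT F1) => r; exact: (Ckon_is_derive _ F1).
have [K0 K00 HK0] := near_bounded_right0 (Ckon_continuous F2 (I : setT 0)).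
have [K1 K10 HK1] := near_bounded_right0 (Ckon_continuous F1 (I : setT 0)).
have [K2 K20 HK2] := near_bounded_right0 (Ckon_continuous F0 (I : setT 0)).
exists (K0 + K1 + K2); first by rewrite !addr_gt0.
by near=> r; split; [have : `|F r| <= K0 by near: r|
  have : `|'D_1 F r| <= K1 by near: r|
  have : `|'D_1 ('D_1 F) r| <= K2 by near: r]; lra.
Unshelve. all: by end_near. Qed.

Let L t := Q * ln (w t) + H t.

Let expL t : 0 < t -> expR (L t) = (sg t ^+ 2)^-1 - 1.
Proof.
move=> t0; have s1 : 0 < 1 - sg t by rewrite subr_gt0 sg_lt1.
rewrite /L expRD [Q * _]mulrC expRM lnK ?posrE ?w_gt0 // wE // -powRrM mulVf ?gt_eqF //.
rewrite powRr1 ?ltW // /H lnK ?posrE //; field.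
by rewrite gt_eqF.
Qed.

Lemma profile_exists : exists S S1 S2 : R -> R,
  [/\ Ckon [set r : R | 0 < r] 2 S,
      (forall r : R, 0 < r -> is_derive r 1 S (S1 r)) /\
      (forall r : R, 0 < r -> is_derive r 1 S1 (S2 r)),
      [/\ S r @[r --> (0 : R)^'+] --> 0, S1 r @[r --> (0 : R)^'+] --> 0 &
          S2 r @[r --> (0 : R)^'+] --> 0],
      forall r, 0 < r -> exists2 y, 0 < y & S r = ta r * y /\
        y `^ P + y `^ Q = (sg r ^+ 2)^-1 - 1 &
      exists B, forall r, 0 < r -> S r * expR (gamma * r) <= B].
Proof.
have [E [E1 [E2 [C [EE EC dE dE1 [C0 E_C]]]]]] := log_inverse P0 PQ.
have E_le t : Q * E t <= t.
  by rewrite -ler_expR -[leRHS]EE lerDr expR_ge0.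
have [KT KT0 TK] := bounded_C2 T_C2.
have [KH KH0 HK] := bounded_C2 H_C2.
pose S r := expR (T r + E (L r)).
have S_C2 : Ckon pos 2 S.
  apply: Ckon_comp_expR; apply: CkonD; first exact: Ckon_sub T_C2.
  apply: (@Ckon_comp _ _ _ setT _ L E) => //.
  apply: CkonD; last exact: Ckon_sub H_C2.
  by apply: CkonM; [exact: Ckon_cst|exact: Ckon_comp_ln].
have D0 F (r : R) : Ckon setT 2 F -> 0 < r -> is_derive r 1 F ('D_1 F r).
  by move=> F2 _; exact: (Ckon_is_derive _ F2).
have D1 F (r : R) : Ckon setT 2 F -> 0 < r -> is_derive r 1 ('D_1 F) ('D_1 ('D_1 F) r).
  move=> F2 _.
  have F1 : Ckon setT 1 ('D_1 F).
    by apply: (Ckon_derive openT F2) => x; exact: (Ckon_is_derive _ F2).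
  exact: (Ckon_is_derive _ F1).
have K0 : 0 < KT + KH by rewrite addr_gt0.
have TK' : \forall r \near (0 : R)^'+, [/\ `|T r| <= KT + KH, `|'D_1 T r| <= KT + KH &
    `|'D_1 ('D_1 T) r| <= KT + KH].
  by apply: filterS TK => r [? ? ?]; split; lra.
have HK' : \forall r \near (0 : R)^'+, [/\ `|H r| <= KT + KH, `|'D_1 H r| <= KT + KH &
    `|'D_1 ('D_1 H) r| <= KT + KH].
  by apply: filterS HK => r [? ? ?]; split; lra.
have [S1 [S2 [dS dS1 S_0 S1_0 S2_0]]] := profile_vanishing Q0 C0 K0 E_le dE dE1 E_C
  (fun r => D0 T r T_C2) (fun r => D1 T r T_C2) (fun r => D0 H r H_C2)
  (fun r => D1 H r H_C2) (fun (r : R) (r0 : pos r) => Ckon_is_derive (1 : R) w_C2 r0)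
  (fun (r : R) (r0 : pos r) => Ckon_is_derive (1 : R) w1_C1 r0) w_gt0 TK' HK' w_0 w1_0 w2_0.
exists S, S1, S2; split=> //.
- move=> r r0; exists (expR (E (L r))); first exact: expR_gt0.
  by rewrite /S expRD /T lnK ?posrE // -!expRM ![E _ * _]mulrC EE expL.
- have gQ : 0 < gamma * Q by rewrite mulr_gt0.
  (* A lower bound on sigma is needed because sigma^2 is a denominator. For r >= r0, expR (gamma Q
     r) >= 1 + 2 c3, so 1 - sigma <= 1/2; on [0, r0] continuity gives a positive minimum. *)
  pose r0 := 2 * c3 / (gamma * Q).
  have r00 : 0 < r0 by rewrite divr_gt0 ?mulr_gt0.
  have far r : r0 <= r -> 2^-1 <= sg r.
    move=> r0r; have rp := lt_le_trans r00 r0r.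
    have : c3 * expR (- (gamma * Q * r)) <= 2^-1.
      rewrite expRN ler_pdivrMr ?expR_gt0 //.
      have := expR_ge1Dx (gamma * Q * r).
      have : gamma * Q * r0 <= gamma * Q * r by rewrite ler_pM2l.
      rewrite /r0 mulrC divfK ?gt_eqF //; lra.
    have := decay rp; lra.
  have [] := @EVT_min R sg 0 r0 (ltW r00).
    by apply: continuous_subspaceT => x; exact: (Ckon_continuous sg_C2).
  move=> c _ near_min.
  pose m := Num.min (sg c) 2^-1.
  have m0 : 0 < m by rewrite lt_min sg_gt0 invr_gt0 ltr0n.
  have m_le r : 0 < r -> m <= sg r.
    move=> rp; rewrite ge_min; case: (leP r r0) => rr0.
      by rewrite near_min // in_itv /= ltW.
    by rewrite far ?orbT // ltW.
  (* From expR L <= 2 c3 expR (- gamma Q r) / m^2 and E(L) <= L/Q: dividing by Q turns the rate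
     gamma Q of (H3) into gamma. *)
  pose K := ln (2 * c3 / m ^+ 2) / Q.
  exists (c4 * expR K) => r rp.
  have L_le : L r <= ln (2 * c3 / m ^+ 2) - gamma * Q * r.
    rewrite -ler_expR expRD lnK ?posrE ?divr_gt0 ?mulr_gt0 ?exprn_gt0 // expL //.
    have sr := sg_gt0 r; have mr := m_le _ rp; have sr1 := sg_lt1 rp.
    have -> : (sg r ^+ 2)^-1 - 1 = (1 - sg r) * (1 + sg r) / sg r ^+ 2.
      by field; rewrite gt_eqF.
    have d := decay rp.
    have n0 : 0 <= 1 - sg r by lra.
    have n1 : (1 - sg r) * (1 + sg r) <= 2 * c3 * expR (- (gamma * Q * r)).
      rewrite -mulrA [leRHS]mulrC; apply: ler_pM => //; lra.
    have n2 : (sg r ^+ 2)^-1 <= (m ^+ 2)^-1.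
      by rewrite lef_pV2 ?posrE ?exprn_gt0 // lerXn2r // nnegrE ltW.
    have p0 : 0 <= 1 + sg r by lra.
    rewrite [leRHS]mulrAC; apply: ler_pM => //; first exact: mulr_ge0.
    by rewrite invr_ge0 ltW // exprn_gt0.
  have E_le' : E (L r) <= K - gamma * r.
    rewrite -(ler_pM2l Q0); apply: le_trans (E_le _) (le_trans L_le _).
    by rewrite /K mulrBr mulrCA divff ?gt_eqF // mulr1 mulrCA mulrA.
  rewrite /S expRD -mulrA ler_pM ?expR_ge0 ?mulr_ge0 //.
    by rewrite /T lnK ?posrE //; apply: Hc4; exists (r *: e1).
  by rewrite -expRD ler_expR; lra.
Qed.

End ProfileData.

(** At amplitude t = tau both nonlinear coefficients, vp t^(p-1) and vq t^(q-1), equal m; this is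
    the role of the relation between v_p, v_q and mu. What remains is m (1 + y^(p-1) + y^(q-1)) = m
    sigma^(-2) = r. *)
Lemma profile_equation (R : realType) (p q m r vp vq y : R) :
  1 < q -> 0 < m -> 0 < r -> 0 < vq ->
  vp = (m `^ (q - p) / vq `^ (1 - p)) `^ (q - 1)^-1 -> 0 < y ->
  y `^ (p - 1) + y `^ (q - 1) = (Num.sqrt (m / r) ^+ 2)^-1 - 1 ->
  let t := (m / vq) `^ (q - 1)^-1 in
  m + vp * (t * y) `^ (p - 1) + vq * (t * y) `^ (q - 1) = r.
Proof.
move=> q1 m0 r0 vq0 vpE y0 y_eq t.
have Qn : q - 1 != 0 by rewrite subr_eq0 gt_eqF.
have t0 : 0 <= t by exact: powR_ge0.
have tQ : vq * t `^ (q - 1) = m.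
  rewrite /t -powRrM mulVf // powRr1; last by rewrite divr_ge0 // ltW.
  by rewrite mulrC divfK // gt_eqF.
(* Written as exponentials of logarithms, this is a comparison of exponents: m has (q - p + p -
   1)/(q - 1) = 1, and vq has 0. *)
have tP : vp * t `^ (p - 1) = m.
  have lm := lnK (m0 : m \is Num.pos).
  have lv := lnK (vq0 : vq \is Num.pos).
  rewrite vpE /t -lm -lv -!expRM -!expRN -!expRD -!expRM -expRD.
  by congr expR; field.
rewrite !powRM ?(ltW y0) // !mulrA tP tQ.
have -> : m + m * y `^ (p - 1) + m * y `^ (q - 1) =
  m * (1 + (y `^ (p - 1) + y `^ (q - 1))) by ring.
rewrite y_eq sqr_sqrtr; last by rewrite divr_ge0 // ltW.
by field; rewrite !gt_eqF.
Qed.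

(** * Restriction of the data to an axis and return to space by radial symmetry *)

Section RadialProfile.
Variables (R : realType) (p q gamma : R).
Variables (rho mu vp vq : 'cV[R]_3 -> R).
Hypotheses (hp : 1 < p) (hpq : p < q).
Hypotheses (rho_gt0 : forall x, 0 < rho x) (mu_gt0 : forall x, 0 < mu x).
Hypotheses (vp_gt0 : forall x, 0 < vp x) (vq_gt0 : forall x, 0 < vq x).
Hypotheses (rho_rad : radial rho) (mu_rad : radial mu).
Hypotheses (vq_rad : radial vq).
Hypotheses (rho_C2 : Ck 2 rho) (mu_C2 : Ck 2 mu) (vq_C2 : Ck 2 vq).
Hypothesis hvp : forall x,
  vp x = (mu x `^ (q - p) / vq x `^ (1 - p)) `^ (q - 1)^-1.
Variables (s ta0 : 'cV[R]_3 -> R).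
Hypotheses (sE : s = sigma rho mu) (taE : ta0 = tau q mu vq).
Hypothesis H1 : forall x, x != 0 -> s 0 * s x < 1.
Hypothesis H2 : to0_C2 (fun x => `|1 - s 0 * s x| `^ (q - 1)^-1).
Hypothesis gamma_gt0 : 0 < gamma.
Hypothesis H3 : has_ubound
  [set `|1 - s 0 * s x| * expR (gamma * (q - 1) * enorm x)
    | x in [set: 'cV[R]_3]].
Hypothesis H4 : has_ubound [set ta0 x | x in [set: 'cV[R]_3]].

Let P := p - 1.
Let Q := q - 1.
Let P0 : 0 < P. Proof. by rewrite subr_gt0. Qed.
Let PQ : P < Q. Proof. by rewrite ltrD2r. Qed.
Let Q0 : 0 < Q. Proof. exact: lt_trans PQ. Qed.
Let e1 : 'cV[R]_3 := basis3 R 0.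
Let pos : set R := [set r | 0 < r].

Let e1_neq0 : e1 != 0.
Proof.
apply/eqP => /colP/(_ 0); rewrite basis3E mxE eqxx => /eqP.
by rewrite oner_eq0.
Qed.

Let enorm_e1 t : enorm (t *: e1) = `|t|.
Proof. by rewrite enormZ enormE dot_basis3 basis3E eqxx sqrtr1 mulr1. Qed.

Let radialE f x : radial f -> f x = f (enorm x *: e1).
Proof. by apply; rewrite enorm_e1 ger0_norm // enorm_ge0. Qed.

Let s_gt0 x : 0 < s x. Proof. by rewrite sE sqrtr_gt0 divr_gt0. Qed.

Let s_rad : radial s.
Proof. by move=> x y xy; rewrite sE /sigma (mu_rad xy) (rho_rad xy). Qed.

Let sg t := s (t *: e1).

Let sg_C2 : Ckon setT 2 sg.
Proof.
rewrite /sg sE.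
apply: Ckon_comp_sqrt; last by move=> x _; rewrite divr_gt0.
apply: CkonM; first exact: Ck_line.
by apply: Ckon_comp_inv; [exact: Ck_line|move=> x _; rewrite gt_eqF].
Qed.

Let sg0 : sg 0 = s 0. Proof. by rewrite /sg scale0r. Qed.

Let W x := `|1 - s 0 * s x| `^ (q - 1)^-1.

Let W_0 : W (t *: e1) @[t --> (0 : R)^'+] --> 0.
Proof. by case: H2 => _ H _ _; exact: (cvg_line e1_neq0 H). Qed.

(** The limit in (H2) does not see the origin itself; continuity of sigma carries it there and gives
    sigma(0)^2 = 1, and positivity selects the root 1. *)
Lemma sigma0_eq1 : s 0 = 1.
Proof.
suff : W 0 = 0.
  move=> /powR_eq0_eq0/eqP; rewrite normr_eq0 subr_eq0 eq_sym -expr2.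
  by rewrite sqrf_eq1 => /orP[/eqP//|/eqP h]; have := s_gt0 0; rewrite h; lra.
(* By contradiction, so that the base of the power is positive at 0, where continuity of [powR] is
   at hand. *)
apply/eqP; case: eqP => // /eqP W0; exfalso.
have n0 : 0 < `|1 - s 0 * s 0|.
  by rewrite lt_neqAle normr_ge0 andbT eq_sym; apply: contra W0 => /eqP h;
    rewrite /W h powR0 // invr_eq0 gt_eqF.
have c : {for 0, continuous (fun t => `|1 - s 0 * sg t| `^ (q - 1)^-1)}.
  apply: (@continuous_comp _ _ _ (fun t => `|1 - s 0 * sg t|) (fun x => x `^ (q - 1)^-1)).
    apply: (@continuous_comp _ _ _ (fun t => 1 - s 0 * sg t) (fun x : R => `|x|)); last exact: norm_continuous.
    apply: (@Ckon_continuous _ _ setT 2) => //; apply: CkonB; first exact: Ckon_cst.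
    by apply: CkonM => //; exact: Ckon_cst.
  apply: (@Ckon_continuous _ _ pos 0); first exact: Ckon_powR.
  by rewrite /pos /= sg0.
have c' : W (t *: e1) @[t --> (0 : R)^'+] --> W 0.
  by have := cvg_at_right_filter c; rewrite sg0; exact.
by move: W0; rewrite -(cvg_unique _ c' W_0) ?eqxx.
Qed.

Let sg_lt1 t : 0 < t -> sg t < 1.
Proof.
move=> t0; have := @H1 (t *: e1); rewrite sigma0_eq1 mul1r; apply.
by rewrite scaler_eq0 negb_or e1_neq0 gt_eqF.
Qed.

Let sg_gt0 t : 0 < sg t. Proof. exact: s_gt0. Qed.

Let ta t := ta0 (t *: e1).

Let tau_gt0 x : 0 < ta0 x.
Proof. by rewrite taE /tau; apply: powR_gt0; rewrite divr_gt0. Qed.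

Let ta_C2 : Ckon setT 2 ta.
Proof.
rewrite /ta taE.
apply: Ckon_comp_powR; last by move=> x _; rewrite divr_gt0.
apply: CkonM; first exact: Ck_line.
by apply: Ckon_comp_inv; [exact: Ck_line|move=> x _; rewrite gt_eqF].
Qed.

Let w := fun t => `|1 - sg t| `^ Q^-1.

Let wE : w = fun t => W (t *: e1).
Proof. by apply/funext => t; rewrite /W sigma0_eq1 mul1r. Qed.

Let w_0 : w t @[t --> (0 : R)^'+] --> 0.
Proof. by rewrite wE; exact: W_0. Qed.

Let w1E : 'D_1 w = fun t => 'D_e1 W (t *: e1).
Proof. by rewrite wE; apply/funext => t; exact: derive_line. Qed.

Let w2E : 'D_1 ('D_1 w) = fun t => 'D_e1 (fun y => 'D_e1 W y) (t *: e1).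
Proof. by rewrite w1E; apply/funext => t; exact: derive_line. Qed.

Let w1_0 : 'D_1 w t @[t --> (0 : R)^'+] --> 0.
Proof.
by rewrite w1E; case: H2 => _ _ /(_ 0) H _; exact: (cvg_line e1_neq0 H).
Qed.

Let w2_0 : 'D_1 ('D_1 w) t @[t --> (0 : R)^'+] --> 0.
Proof.
by rewrite w2E; case: H2 => _ _ _ /(_ 0 0) H; exact: (cvg_line e1_neq0 H).
Qed.

Lemma radial_profile : exists S S1 S2 : R -> R,
  [/\ Ckon [set r : R | 0 < r] 2 S,
      (forall r : R, 0 < r -> is_derive r 1 S (S1 r)) /\
      (forall r : R, 0 < r -> is_derive r 1 S1 (S2 r)),
      [/\ S r @[r --> (0 : R)^'+] --> 0, S1 r @[r --> (0 : R)^'+] --> 0 &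
          S2 r @[r --> (0 : R)^'+] --> 0],
      (forall r, 0 < r -> 0 < S r) /\ (forall x, x != 0 ->
        mu x + vp x * S (enorm x) `^ (p - 1) + vq x * S (enorm x) `^ (q - 1) = rho x) &
      exists B, forall r, 0 < r -> S r * expR (gamma * r) <= B].
Proof.
have [C3 HC3] := H3; have [c4 HC4] := H4.
(* The bound from (H3) is made positive since it will stand under a logarithm. *)
have [c3 c30 Cc3] : exists2 c3, 0 < c3 & C3 <= c3.
  by exists (Num.max C3 1); rewrite ?lt_max ?le_max ?ltr01 ?lexx ?orbT.
have decay r : 0 < r -> 1 - sg r <= c3 * expR (- (gamma * Q * r)).
  move=> r0; rewrite expRN ler_pdivlMr; last exact: expR_gt0.
  apply: le_trans Cc3; apply: HC3; exists (r *: e1); first by [].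
  rewrite sigma0_eq1 mul1r enorm_e1 (gtr0_norm r0) ger0_norm; first by [].
  by rewrite subr_ge0; exact: ltW (sg_lt1 r0).
have ta_le t : ta t <= c4 by apply: HC4; exists (t *: e1).
clear HC3 HC4.
have [S [S1 [S2 [SC dS SL Sy SB]]]] := profile_exists P0 PQ gamma_gt0 c30 sg_C2 ta_C2
  sg_gt0 (fun t => tau_gt0 (t *: e1)) sg_lt1 w_0 w1_0 w2_0 decay ta_le.
exists S, S1, S2; split; [exact: SC|exact: dS|exact: SL| |exact: SB].
split=> [r r0|x x0].
  by have [y y0 [-> _]] := Sy r r0; exact: (mulr_gt0 (tau_gt0 _) y0).
have [y y0 [SE y_eq]] := Sy _ (enorm_gt0 x0).
have sgx : sg (enorm x) = Num.sqrt (mu x / rho x).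
  by rewrite /sg -(radialE x s_rad) sE.
have tax : ta (enorm x) = (mu x / vq x) `^ (q - 1)^-1.
  by rewrite /ta taE /tau -(radialE x mu_rad) -(radialE x vq_rad).
rewrite sgx in y_eq; rewrite SE tax.
exact: profile_equation (lt_trans hp hpq) (mu_gt0 x) (rho_gt0 x) (vq_gt0 x) (hvp x) y0 y_eq.
Qed.

End RadialProfile.

(** * The breathers *)

Lemma derCE (R : realType) (V : normedModType R) (v : V) (F : V -> 'cV[R[i]]_3) w i :
  derC v F w i 0 = 'D_v (fun y => complex.Re (F y i 0)) w
                   +i* 'D_v (fun y => complex.Im (F y i 0)) w.
Proof. by rewrite mxE. Qed.

Lemma curlE (R : realType) (F : 'cV[R]_3 -> 'cV[R[i]]_3) x i :
  curl F x i 0 =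
    ('D_(basis3 R (i + 1)) (fun y => complex.Re (F y (i + 2) 0)) x
     +i* 'D_(basis3 R (i + 1)) (fun y => complex.Im (F y (i + 2) 0)) x)
  - ('D_(basis3 R (i + 2)) (fun y => complex.Re (F y (i + 1) 0)) x
     +i* 'D_(basis3 R (i + 2)) (fun y => complex.Im (F y (i + 1) 0)) x).
Proof. by rewrite mxE; congr (_ - _); exact: derCE. Qed.

Section Wave.
Variable R : realType.
Local Notation V := 'cV[R]_3.
Variables S S1 S2 : R -> R.
Hypothesis S_C2 : Ckon [set r : R | 0 < r] 2 S.
Hypothesis dS : forall r : R, 0 < r -> is_derive r 1 S (S1 r).
Hypothesis dS1 : forall r : R, 0 < r -> is_derive r 1 S1 (S2 r).
Hypothesis S_0 : S r @[r --> (0 : R)^'+] --> 0.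
Hypothesis S1_0 : S1 r @[r --> (0 : R)^'+] --> 0.
Hypothesis S2_0 : S2 r @[r --> (0 : R)^'+] --> 0.
Hypothesis S_gt0 : forall r, 0 < r -> 0 < S r.

Let f := field_comp S.

Let f_C2 i : Ckon setT 2 (f i).
Proof. by have [] := field_comp_C2 S_C2 dS dS1 S_0 S1_0 S2_0 i. Qed.

Let df i (v x : V) : is_derive x v (f i) (field_deriv S S1 i v x).
Proof. by have [_] := field_comp_C2 S_C2 dS dS1 S_0 S1_0 S2_0 i. Qed.

Definition wave (a : R) (xt : V * R) : 'cV[R[i]]_3 :=
  \col_i ((cos (xt.2 + a * dot xt.1 xt.1) * field_comp S i xt.1)
          +i* (sin (xt.2 + a * dot xt.1 xt.1) * field_comp S i xt.1)).

Lemma wave_Re a xt i :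
  complex.Re (wave a xt i 0) = cos (xt.2 + a * dot xt.1 xt.1) * field_comp S i xt.1.
Proof. by rewrite mxE. Qed.

Lemma wave_Im a xt i :
  complex.Im (wave a xt i 0) = sin (xt.2 + a * dot xt.1 xt.1) * field_comp S i xt.1.
Proof. by rewrite mxE. Qed.

Lemma wave_C2 a : CkC 2 (wave a).
Proof.
pose ph (w : V * R) := w.2 + a * dot w.1 w.1.
have Cfst (g : V -> R) : Ckon setT 2 g -> Ckon setT 2 (fun w : V * R => g w.1).
  move=> Hg; apply: (@Ckon_affine _ (V * R)%type V setT _ g fst fst) => //.
  by move=> x; exact: cvg_fst.
have Cph : Ckon setT 2 ph.
  apply: CkonD.
    by apply: (@Ckon_lin _ _ _ _ _ snd) => // x; exact: cvg_snd.
  by apply: CkonM; [exact: Ckon_cst|apply: (Cfst (fun x => dot x x)); exact: Ckon_sqr_enorm].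
have [Csin Ccos] := Ckon_sincos R 2.
move=> i; split; apply/Ck_Ckon.
  have -> : (fun w => complex.Re (wave a w i 0)) = fun w => cos (ph w) * f i w.1.
    by apply/funext => w; exact: wave_Re.
  by apply: CkonM; [exact: (@Ckon_comp _ _ _ setT _ ph cos)|exact: (Cfst (f i))].
have -> : (fun w => complex.Im (wave a w i 0)) = fun w => sin (ph w) * f i w.1.
  by apply/funext => w; exact: wave_Im.
by apply: CkonM; [exact: (@Ckon_comp _ _ _ setT _ ph sin)|exact: (Cfst (f i))].
Qed.

(** The field is parallel to x, hence to the gradient 2ax of the phase; their cross product, which
    is the phase's share of the curl, vanishes. *)
Let f_coord i j x : f i x * x j 0 = f j x * x i 0.
Proof. by rewrite /f /field_comp /dir !dot_basis3; ring. Qed.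

Let is_derive_phase a t (v x : V) :
  is_derive x v (fun y => t + a * dot y y) (2 * a * dot x v).
Proof.
have dd := is_derive_sqr_enorm x v.
by apply: is_derive_eq; rewrite /GRing.scale /=; ring.
Qed.

Let dRe a t i (v x : V) : 'D_v (fun y => complex.Re (wave a (y, t) i 0)) x =
  cos (t + a * dot x x) * field_deriv S S1 i v x
  - sin (t + a * dot x x) * (2 * a * dot x v) * f i x.
Proof.
under eq_fun do rewrite wave_Re /=.
have dp := is_derive_chain (is_derive_phase a t v x) (is_derive_cos _).
have d := df i v x.
suff H : is_derive x v (fun y => cos (t + a * dot y y) * f i y)
  (cos (t + a * dot x x) * field_deriv S S1 i v x
  - sin (t + a * dot x x) * (2 * a * dot x v) * f i x) by case: H.
by apply: is_derive_eq; rewrite /GRing.scale /=; ring.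
Qed.

Let dIm a t i (v x : V) : 'D_v (fun y => complex.Im (wave a (y, t) i 0)) x =
  sin (t + a * dot x x) * field_deriv S S1 i v x
  + cos (t + a * dot x x) * (2 * a * dot x v) * f i x.
Proof.
under eq_fun do rewrite wave_Im /=.
have dp := is_derive_chain (is_derive_phase a t v x) (is_derive_sin _).
have d := df i v x.
suff H : is_derive x v (fun y => sin (t + a * dot y y) * f i y)
  (sin (t + a * dot x x) * field_deriv S S1 i v x
  + cos (t + a * dot x x) * (2 * a * dot x v) * f i x) by case: H.
by apply: is_derive_eq; rewrite /GRing.scale /=; ring.
Qed.

Lemma curl_wave a t x : curl (fun y => wave a (y, t)) x = 0.
Proof.
apply/colP => i; rewrite curlE [RHS]mxE.
(* It suffices that the Jacobian be symmetric: the amplitude part by [field_deriv_sym], the phase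
   part by [f_coord]. *)
suff H j k : 'D_(basis3 R j) (fun y => complex.Re (wave a (y, t) k 0)) x
    +i* 'D_(basis3 R j) (fun y => complex.Im (wave a (y, t) k 0)) x =
    'D_(basis3 R k) (fun y => complex.Re (wave a (y, t) j 0)) x
    +i* 'D_(basis3 R k) (fun y => complex.Im (wave a (y, t) j 0)) x.
  by apply/eqP; rewrite subr_eq0; apply/eqP; exact: H.
rewrite !dRe !dIm !dot_basis3 (field_deriv_sym S S1 j k).
have E := f_coord j k x.
congr (_ +i* _).
- congr (_ - _); rewrite -!mulrA; congr (_ * (_ * (_ * _))).
  by rewrite mulrC -E mulrC.
- congr (_ + _); rewrite -!mulrA; congr (_ * (_ * (_ * _))).
  by rewrite mulrC -E mulrC.
Qed.

Lemma d_tt_wave a x t : d_tt (wave a) x t = - wave a (x, t).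
Proof.
have dp (s : R) : is_derive s 1 (fun s : R => s + a * dot x x) 1.
  by apply: is_derive_eq; rewrite addr0.
have dc c (s : R) : is_derive s 1 (fun s : R => cos (s + a * dot x x) * c)
    (- sin (s + a * dot x x) * c).
  have ? := is_derive_chain (dp s) (is_derive_cos _).
  by apply: is_derive_eq; rewrite /GRing.scale /=; ring.
have ds c (s : R) : is_derive s 1 (fun s : R => sin (s + a * dot x x) * c)
    (cos (s + a * dot x x) * c).
  have ? := is_derive_chain (dp s) (is_derive_sin _).
  by apply: is_derive_eq; rewrite /GRing.scale /=; ring.
have E1 : derC (1 : R) (fun s => wave a (x, s)) = fun s => \col_i
   ((- sin (s + a * dot x x) * f i x) +i* (cos (s + a * dot x x) * f i x)).
  apply/funext => s; apply/colP => i; rewrite derCE [RHS]mxE; congr (_ +i* _).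
    under eq_fun do rewrite wave_Re /=.
    by have [_] := dc (f i x) s.
  under eq_fun do rewrite wave_Im /=.
  by have [_] := ds (f i x) s.
rewrite /d_tt E1; apply/colP => i; rewrite derCE [RHS]mxE [in RHS]mxE.
have -> : (fun y => complex.Re ((\col_i0 ((- sin (y + a * dot x x) * f i0 x)
    +i* (cos (y + a * dot x x) * f i0 x)) : 'cV[R[i]]_3) i 0)) =
    fun y => sin (y + a * dot x x) * (- f i x).
  by apply/funext => y; rewrite mxE /=; ring.
have -> : (fun y => complex.Im ((\col_i0 ((- sin (y + a * dot x x) * f i0 x)
    +i* (cos (y + a * dot x x) * f i0 x)) : 'cV[R[i]]_3) i 0)) =
    fun y => cos (y + a * dot x x) * f i x.
  by apply/funext => y; rewrite mxE /=.
have [_ ->] := ds (- f i x) t; have [_ ->] := dc (f i x) t.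
by apply/eqP; rewrite eq_complex /=; apply/andP; split; apply/eqP; rewrite /f; ring.
Qed.

Lemma wave0 a t : wave a (0, t) = 0.
Proof.
by apply/colP => i; rewrite !mxE /= field_comp0 !mulr0.
Qed.

Lemma hnorm_wave a x t : x != 0 -> hnorm (wave a (x, t)) = S (enorm x).
Proof.
move=> x0; have r0 := enorm_gt0 x0.
rewrite /hnorm (_ : \sum_i _ = S (enorm x) ^+ 2).
  by rewrite sqrtr_sqr gtr0_norm // S_gt0.
rewrite (eq_bigr (fun i => (S (enorm x) / enorm x) ^+ 2 * (x i 0 * x i 0))); last first.
  move=> i _; rewrite wave_Re wave_Im /= !exprMn -mulrDl cos2Dsin2 mul1r.
  rewrite /field_comp /dir dot_basis3; ring.
by rewrite -mulr_sumr -/(dot x x) -sqr_enorm -exprMn divfK // gt_eqF.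
Qed.

Lemma wave_periodic a x t : wave a (x, t + 2 * pi) = wave a (x, t).
Proof.
apply/colP => i; rewrite !mxE /=.
have -> : t + 2 * pi + a * dot x x = t + a * dot x x + pi *+ 2.
  by rewrite -mulr_natl; ring.
by rewrite (cosD _ (pi *+ 2)) (sinD _ (pi *+ 2)) cos2pi sin2pi !mulr0 !mulr1 subr0 addr0.
Qed.

Lemma wave_monochromatic a :
  wave a = monochromatic (2 * pi) (fun x => wave a (x, 0)).
Proof.
apply/funext => -[x t]; apply/colP => i; rewrite !mxE /=.
rewrite divff ?mul1r ?mulf_neq0 ?pnatr_eq0 ?gt_eqF ?pi_gt0 // add0r.
rewrite cosD sinD.
apply/eqP; rewrite eq_complex /=; apply/andP; split; apply/eqP; ring.
Qed.

(* Evaluating on the axis, equality up to a time shift [t0] forces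
   [cos ((b - a) r ^+ 2 - t0) = 1] for every r > 0. *)
Lemma wave_translate_inj a b t0 : wave b = time_translate t0 (wave a) -> a = b.
Proof.
move=> E; apply/eqP; rewrite eq_sym -subr_eq0; apply: contraT => c0.
have cos1 z : 0 < z -> cos ((b - a) * z - t0) = 1.
  move=> z0; pose x : V := Num.sqrt z *: basis3 R 0.
  have xx : dot x x = z.
    rewrite -sqr_enorm enormZ enormE dot_basis3 basis3E eqxx sqrtr1 mulr1.
    by rewrite ger0_norm ?sqrtr_ge0 // sqr_sqrtr // ltW.
  have x0 : x != 0.
    by apply: contraTneq z0 => x0; rewrite -xx x0 -sqr_enorm enorm0 expr0n ltxx.
  have fx : f 0 x != 0.
    have r0 := enorm_gt0 x0.
    have x00 : x 0 0 != 0 by rewrite mxE basis3E eqxx mulr1 gt_eqF // sqrtr_gt0.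
    rewrite /f /field_comp /dir dot_basis3; apply: mulf_neq0.
      by rewrite gt_eqF // S_gt0.
    by apply: mulf_neq0; rewrite // invr_neq0 // gt_eqF.
  have /colP/(_ 0) := congr1 (@^~ (x, 0)) E.
  rewrite !mxE /= xx !add0r => /eqP; rewrite eq_complex /= => /andP[/eqP ec /eqP es].
  have {}ec := mulIf fx ec; have {}es := mulIf fx es.
  have -> : (b - a) * z - t0 = b * z - (t0 + a * z) by ring.
  by rewrite cosB ec es -!expr2 cos2Dsin2.
have n0 : 0 < `|b - a| by rewrite normr_gt0.
(* Between z = 1 and z = 1 + pi / |b - a| the argument moves by pi in absolute value, so the cosine
   changes sign and cannot be 1 at both. *)
have := cos1 (1 + pi / `|b - a|) _.
rewrite addr_gt0 ?divr_gt0 ?pi_gt0 // => /(_ isT).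
have := cos1 1 ltr01.
have [h|h] := lerP 0 (b - a).
- rewrite (ger0_norm h).
  have -> : (b - a) * (1 + pi / (b - a)) - t0 = (b - a) * 1 - t0 + pi by field.
  rewrite cosDpi => ->; lra.
- rewrite (ltr0_norm h).
  have -> : (b - a) * (1 + pi / - (b - a)) - t0 = - (- ((b - a) * 1 - t0) + pi).
    by rewrite invrN; field.
  rewrite cosN cosDpi cosN => ->; lra.
Qed.

End Wave.

Theorem theorem4p2 (R : realType) (p q gamma : R)
    (M : 'cV[R]_3 -> 'M[R]_3) (rho mu vp vq : 'cV[R]_3 -> R)
    (hp : 1 < p) (hpq : p < q)
    (rho_gt0 : forall x, 0 < rho x) (mu_gt0 : forall x, 0 < mu x)
    (vp_gt0 : forall x, 0 < vp x) (vq_gt0 : forall x, 0 < vq x)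
    (rho_rad : radial rho) (mu_rad : radial mu)
    (vp_rad : radial vp) (vq_rad : radial vq)
    (rho_C2 : Ck 2 rho) (mu_C2 : Ck 2 mu) (vp_C2 : Ck 2 vp) (vq_C2 : Ck 2 vq)
    (hvp : forall x,
      vp x = (mu x `^ (q - p) / vq x `^ (1 - p)) `^ (q - 1)^-1) :
  let s := sigma rho mu in
  let T := 2 * pi * s 0 in
  forall (H1 : forall x, x != 0 -> s 0 * s x < 1)
    (H2 : to0_C2 (fun x => `|1 - s 0 * s x| `^ (q - 1)^-1))
    (gamma_gt0 : 0 < gamma)
    (H3 : has_ubound
      [set `|1 - s 0 * s x| * expR (gamma * (q - 1) * enorm x)
        | x in [set: 'cV[R]_3]])
    (H4 : has_ubound [set tau q mu vq x | x in [set: 'cV[R]_3]]),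
  exists A : set ('cV[R]_3 * R -> 'cV[R[i]]_3),
    continuum_mod_time A /\
    forall U, A U ->
      breather p q M rho mu vp vq T U /\
      exists2 u : 'cV[R]_3 -> 'cV[R[i]]_3, U = monochromatic T u &
        has_ubound
          [set hnorm (u x) * expR (gamma * enorm x) | x in [set: 'cV[R]_3]].
Proof.
move=> s T H1 H2 gamma_gt0 H3 H4.
have s0 : s 0 = 1 := sigma0_eq1 hp hpq rho_gt0 mu_gt0 rho_C2 mu_C2 erefl H2.
have TE : T = 2 * pi by rewrite /T s0 mulr1.
have [S [S1 [S2 [S_C2 [dS dS1] [S_0 S1_0 S2_0] [S_gt0 S_eq] [B SB]]]]] :=
  radial_profile hp hpq rho_gt0 mu_gt0 vq_gt0 rho_rad mu_rad vq_rad rho_C2 mu_C2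
    vq_C2 hvp erefl erefl H1 H2 gamma_gt0 H3 H4.
clear H1 H2 H3 H4.
(* [B] controls only r > 0; the maximum with 0 covers the origin, where the wave is zero. *)
have wave_bound a x t : hnorm (wave S a (x, t)) * expR (gamma * enorm x) <= Num.max B 0.
  have [->|x0] := eqVneq x 0.
    rewrite wave0 /hnorm big1 => [|i _]; last by rewrite mxE /= expr0n addr0.
    by rewrite sqrtr0 mul0r le_max lexx orbT.
  by rewrite (hnorm_wave S_gt0) // le_max SB ?enorm_gt0.
exists (range (wave S)); split.
  (* Injectivity of the parametrization by a is the case of a zero time shift. *)
  split; first by apply: inj_card_eq => a b _ _ E;
    apply: (wave_translate_inj S_gt0 (t0 := 0)); rewrite -E;
    apply/funext => -[x t]; rewrite /time_translate addr0.
  move=> U V t0 [a _ <-] [b _ <-] E.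
  by rewrite (wave_translate_inj S_gt0 E).
move=> U [a _ <-]; split; last first.
  exists (fun x => wave S a (x, 0)); first by rewrite TE; exact: wave_monochromatic.
  by exists (Num.max B 0) => _ [x _ <-]; exact: wave_bound.
(* The inner curl is zero before M acts, so the outer curl is that of the zero field, whatever M
   is. *)
have M0 t : M_curl M (wave S a) t = fun=> 0.
  apply/funext => x; rewrite /M_curl.
  by rewrite (curl_wave S_C2 dS dS1 S_0 S1_0 S2_0) mulmx0.
have C0 k : CkC k (fun _ : 'cV[R]_3 => 0 : 'cV[R[i]]_3).
  by move=> i; split; apply/Ck_Ckon; under eq_fun do rewrite mxE; exact: Ckon_cst.
have curl0 x : curl (fun _ : 'cV[R]_3 => 0 : 'cV[R[i]]_3) x = 0.
  apply/colP => i; rewrite curlE [RHS]mxE.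
  have -> j : (fun _ : 'cV[R]_3 => complex.Re ((0 : 'cV[R[i]]_3) j 0)) = cst 0.
    by apply/funext => y; rewrite mxE.
  have -> j : (fun _ : 'cV[R]_3 => complex.Im ((0 : 'cV[R[i]]_3) j 0)) = cst 0.
    by apply/funext => y; rewrite mxE.
  by rewrite !derive_cst subrr.
split.
- split.
  + exact: (wave_C2 S_C2 dS dS1 S_0 S1_0 S2_0).
  + by move=> t; rewrite M0.
  move=> x t; rewrite M0 curl0 addr0 d_tt_wave.
  have [->|x0] := eqVneq x 0; first by rewrite wave0 oppr0 !scaler0 !addr0.
  rewrite (hnorm_wave S_gt0) // scalerN -scaleNr -!scalerDl -!rmorphN -!rmorphD /=.
  have <- := S_eq x x0.
  set c := (X in X%:C *: _).
  have -> : c = 0 by rewrite /c; ring.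
  by rewrite scale0r.
- by move=> x t; rewrite TE; exact: wave_periodic.
- by exists gamma => //; exists (Num.max B 0) => _ [[x t] _ <-]; exact: wave_bound.
Qed.
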